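(* Let $Q$ be a finite quandle. Then there exist integer-valued polynomials $P_Q,\,P_Q^{\mathrm{dom}}\in\mathbb{Q}[x]$ such that $$\int_{\widehat{B_n}} c_{Q,n}\,d\mu = P_Q(n)\qquad\text{and}\qquad \int_{\widehat{B_n}} c_{Q,n}^{\mathrm{dom}}\,d\mu = P_Q^{\mathrm{dom}}(n)$$ for all sufficiently large $n\in\mathbb{N}$. Here $c_{Q,n}$ and $c_{Q,n}^{\mathrm{dom}}$ are the continuous extensions to the profinite completion $\widehat{B_n}$ of the braid group $B_n$ of the functions counting, respectively, $Q$-colorings and dominant $Q$-colorings of the closure $\overline\sigma$ of $\sigma\in B_n$, and $\mu$ is the normalized Haar measure on $\widehat{B_n}$.
   Context: A quandle is a set $Q$ with a binary operation $(x,y)\mapsto {}^{x}y$ such that (Q1) ${}^{x}x=x$ for all $x$; (Q2) for every $x$ the map $\varphi_x\colon Q\to Q$, $\varphi_x(y)={}^{x}y$, is a bijection; (Q3) ${}^{x}({}^{y}z)={}^{({}^{x}y)}({}^{x}z)$ for all $x,y,z$. A morphism of quandles is a map $f$ with $f({}^{x}y)={}^{f(x)}f(y)$. A finite quandle is one with finite underlying set. Oriented (tame) links in $S^3$ are described by diagrams $D$ with a finite set $arcs(D)$ of oriented arcs. For an arc $x$ ending at a crossing as under-strand, $n_x$ is the next arc (the continuation of the under-strand), $c_x$ is the arc passing over $x$ and $n_x$ at that crossing, and $\varepsilon_x\in\{\pm1\}$ is the orientation of the crossing: rotating the picture so that both strands point downwards, $\varepsilon_x=1$ if the over-strand goes from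 upper left to lower right, and $\varepsilon_x=-1$ if it goes from upper right to lower left. The fundamental quandle $Q_L$ of the link $L$ is the quandle generated by $arcs(D)$ subject to the relations $\varphi_{c_x}^{\varepsilon_x}(x)=n_x$; up to isomorphism it does not depend on the diagram $D$ of $L$. The set of $Q$-colorings of $L$ is $\mathrm{Col}_Q(L)=\mathrm{Hom}(Q_L,Q)$ (quandle morphisms); equivalently, maps $f\colon arcs(D)\to Q$ with $\varphi_{f(c_x)}^{\varepsilon_x}(f(x))=f(n_x)$ at every crossing. The set of dominant $Q$-colorings is $\mathrm{Col}_Q^{\mathrm{dom}}(L)=\{f\in\mathrm{Hom}(Q_L,Q): f \text{ surjective}\}$. Both are finite when $Q$ is finite. $B_n$ is the Artin braid group on $n$ strands, with generators $\sigma_1,\dots,\sigma_{n-1}$ and relations $\sigma_i\sigma_{i+1}\sigma_i=\sigma_{i+1}\sigma_i\sigma_{i+1}$ and $[\sigma_i,\sigma_j]=1$ for $|i-j|\ge2$. Braids are oriented downwards; in $\sigma_i$ the strand starting on top at position $i$ passes over the strand starting at position $i+1$. The closure $\overline\sigma$ is the oriented link obtained by joining the bottom endpoints of $\sigma$ to the corresponding top endpoints without introducing crossings. $\widehat{B_n}$ is the profinite completion of $B_n$, with Haar measure $\mu$ of total mass $1$. The functions $B_n\to\mathbb{N}$, $\sigma\mapsto|\mathrm{Col}_Q(\overline\sigma)|$ and $\sigma\mapsto|\mathrm{Col}^{\mathrm{dom}}_Q(\overline\sigma)|$, factor through finite quotients of $B_n$, so they extend uniquely to continuous (locally constant) functions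 $c_{Q,n}$ and $c_{Q,n}^{\mathrm{dom}}$ on $\widehat{B_n}$. A polynomial $P\in\mathbb{Q}[x]$ is integer-valued if $P(\mathbb{Z})\subseteq\mathbb{Z}$. *)

(* Defs.v *)
From HB Require Import structures.
From mathcomp Require Import all_boot all_order all_algebra perm finmap.
From mathcomp Require Import all_classical all_reals all_analysis.

Set Implicit Arguments.
Unset Strict Implicit.
Unset Printing Implicit Defensive.

Import GRing.Theory Num.Theory.

Local Open Scope classical_set_scope.
Local Open Scope quotient_scope.

(* [qop x y] is the product written $^{x}y$, i.e. $\varphi_x(y)$. *)
HB.mixin Record isQuandle Q := {
  qop : Q -> Q -> Q;
  qopxx : forall x, qop x x = x;
  qop_bij : forall x, bijective (qop x);
  qopD : forall x y z, qop x (qop y z) = qop (qop x y) (qop x z)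
}.

#[short(type="quandleType")]
HB.structure Definition Quandle := {Q of isQuandle Q & Choice Q}.

#[short(type="finQuandleType")]
HB.structure Definition FinQuandle := {Q of isQuandle Q & Finite Q}.

Definition quandle_morphism (X Y : quandleType) (f : X -> Y) : Prop :=
  forall x y, f (qop x y) = qop (f x) (f y).

(* [QInv s t] stands for $\varphi_s^{-1}(t)$. *)
Inductive qterm (A : Type) : Type :=
| QGen of A
| QOp of qterm A & qterm A
| QInv of qterm A & qterm A.

HB.instance Definition _ (A : Type) := gen_eqMixin (qterm A).
HB.instance Definition _ (A : Type) := gen_choiceMixin (qterm A).

Section PresentedQuandle.
Variables (A : Type) (rel : qterm A -> qterm A -> Prop).

Inductive qcong : qterm A -> qterm A -> Prop :=
| qcong_rel s t : rel s t -> qcong s t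
| qcong_refl s : qcong s s
| qcong_sym s t : qcong s t -> qcong t s
| qcong_trans s t u : qcong s t -> qcong t u -> qcong s u
| qcong_op s s' t t' : qcong s s' -> qcong t t' -> qcong (QOp s t) (QOp s' t')
| qcong_inv s s' t t' :
    qcong s s' -> qcong t t' -> qcong (QInv s t) (QInv s' t')
| qcong_xx s : qcong (QOp s s) s
| qcong_opK s t : qcong (QInv s (QOp s t)) t
| qcong_invK s t : qcong (QOp s (QInv s t)) t
| qcong_D s t u : qcong (QOp s (QOp t u)) (QOp (QOp s t) (QOp s u)).

Definition qcongb s t : bool := `[< qcong s t >].

Lemma qcongb_refl : reflexive qcongb.
Proof. by move=> s; apply/asboolP/qcong_refl. Qed.

Lemma qcongb_sym : symmetric qcongb.
Proof. by move=> s t; apply/asboolP/asboolP => /qcong_sym. Qed.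

Lemma qcongb_trans : transitive qcongb.
Proof.
by move=> t s u /asboolP st /asboolP tu; apply/asboolP/(qcong_trans st tu).
Qed.

Canonical qcong_equiv := EquivRel qcongb qcongb_refl qcongb_sym qcongb_trans.

Definition presented_quandle : Type := {eq_quot qcong_equiv}.

HB.instance Definition _ := Choice.on presented_quandle.
HB.instance Definition _ := EqQuotient.on presented_quandle.

Lemma qpiP s t : \pi_presented_quandle s = \pi_presented_quandle t <-> qcong s t.
Proof. by split=> [/eqmodP/asboolP //|st]; apply/eqmodP/asboolP. Qed.

Lemma qcong_repr s : qcong (repr (\pi_presented_quandle s)) s.
Proof. by apply/qpiP; rewrite reprK. Qed.

Definition pq_op (x y : presented_quandle) : presented_quandle :=
  \pi_presented_quandle (QOp (repr x) (repr y)).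

Definition pq_inv (x y : presented_quandle) : presented_quandle :=
  \pi_presented_quandle (QInv (repr x) (repr y)).

Definition pq_gen (a : A) : presented_quandle :=
  \pi_presented_quandle (QGen a).

Lemma pq_op_pi s t :
  pq_op (\pi_presented_quandle s) (\pi_presented_quandle t)
  = \pi_presented_quandle (QOp s t).
Proof. by apply/qpiP/qcong_op; exact: qcong_repr. Qed.

Lemma pq_inv_pi s t :
  pq_inv (\pi_presented_quandle s) (\pi_presented_quandle t)
  = \pi_presented_quandle (QInv s t).
Proof. by apply/qpiP/qcong_inv; exact: qcong_repr. Qed.

Lemma pq_opxx x : pq_op x x = x.
Proof. by rewrite -[x]reprK pq_op_pi; apply/qpiP/qcong_xx. Qed.

Lemma pq_opK x : cancel (pq_op x) (pq_inv x).
Proof.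
move=> y; rewrite -[x]reprK -[y]reprK pq_op_pi pq_inv_pi.
exact/qpiP/qcong_opK.
Qed.

Lemma pq_invK x : cancel (pq_inv x) (pq_op x).
Proof.
move=> y; rewrite -[x]reprK -[y]reprK pq_inv_pi pq_op_pi.
exact/qpiP/qcong_invK.
Qed.

Lemma pq_op_bij x : bijective (pq_op x).
Proof. by exists (pq_inv x); [exact: pq_opK | exact: pq_invK]. Qed.

Lemma pq_opD x y z : pq_op x (pq_op y z) = pq_op (pq_op x y) (pq_op x z).
Proof.
elim/quotW: x => x; elim/quotW: y => y; elim/quotW: z => z.
rewrite (pq_op_pi y z) (pq_op_pi x y) (pq_op_pi x z) !pq_op_pi.
exact/qpiP/qcong_D.
Qed.

HB.instance Definition _ :=
  isQuandle.Build presented_quandle pq_opxx pq_op_bij pq_opD.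

End PresentedQuandle.

(* The combinatorial content of an oriented link diagram.  At a crossing [k]
   the arc [under_in k] ends as under-strand, [under_out k] is its continuation
   and [over k] passes over; [positive k] means that the sign is $+1$.
   With $x$ = [under_in k] these are $n_x$ = [under_out k], $c_x$ = [over k];
   an arc that is a circle without undercrossing is [under_in] of no crossing. *)
Record link_diagram := LinkDiagram {
  arcs : finType;
  crossings : finType;
  under_in : crossings -> arcs;
  under_out : crossings -> arcs;
  over : crossings -> arcs;
  positive : crossings -> bool
}.

(* $\varphi_{c_x}^{\varepsilon_x}(x) = n_x$ *)
Inductive wirtinger_rel (D : link_diagram) :
    qterm (arcs D) -> qterm (arcs D) -> Prop :=
| WirtingerRel (k : crossings D) :
    wirtinger_rel
      ((if positive k then @QOp _ else @QInv _)
         (QGen (over k)) (QGen (under_in k)))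
      (QGen (under_out k)).

Definition fundamental_quandle (D : link_diagram) : quandleType :=
  presented_quandle (@wirtinger_rel D).

Definition Col (Q : quandleType) (D : link_diagram) :
    set (fundamental_quandle D -> Q) :=
  [set f | quandle_morphism f].

Definition Col_dom (Q : quandleType) (D : link_diagram) :
    set (fundamental_quandle D -> Q) :=
  [set f | quandle_morphism f /\ range f = setT].

Arguments Col Q D : clear implicits.
Arguments Col_dom Q D : clear implicits.

(* A word is a list of letters; [(i, true)] is the generator [i] and
   [(i, false)] its inverse. *)
Notation word I := (seq (I * bool)).

Section PresentedGroup.
Variables (I : choiceType) (rel : word I -> word I -> Prop).

Inductive wcong : word I -> word I -> Prop :=
| wcong_rel u v : rel u v -> wcong u v
| wcong_refl u : wcong u u
| wcong_sym u v : wcong u v -> wcong v u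
| wcong_trans u v w : wcong u v -> wcong v w -> wcong u w
| wcong_cat u u' v v' : wcong u u' -> wcong v v' -> wcong (u ++ v) (u' ++ v')
| wcong_cancel i b : wcong [:: (i, b); (i, ~~ b)] [::].

Definition wcongb u v : bool := `[< wcong u v >].

Lemma wcongb_refl : reflexive wcongb.
Proof. by move=> s; apply/asboolP/wcong_refl. Qed.

Lemma wcongb_sym : symmetric wcongb.
Proof. by move=> s t; apply/asboolP/asboolP => /wcong_sym. Qed.

Lemma wcongb_trans : transitive wcongb.
Proof.
by move=> t s u /asboolP st /asboolP tu; apply/asboolP/(wcong_trans st tu).
Qed.

Canonical wcong_equiv := EquivRel wcongb wcongb_refl wcongb_sym wcongb_trans.

Definition presented_group : Type := {eq_quot wcong_equiv}.

HB.instance Definition _ := Choice.on presented_group.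
HB.instance Definition _ := EqQuotient.on presented_group.

Lemma wpiP u v : \pi_presented_group u = \pi_presented_group v <-> wcong u v.
Proof. by split=> [/eqmodP/asboolP //|st]; apply/eqmodP/asboolP. Qed.

Lemma wcong_repr u : wcong (repr (\pi_presented_group u)) u.
Proof. by apply/wpiP; rewrite reprK. Qed.

Definition winv (u : word I) : word I := rev [seq (a.1, ~~ a.2) | a <- u].

Lemma winvK : involutive winv.
Proof.
move=> u; rewrite /winv map_rev revK -map_comp -[RHS]map_id.
by apply: eq_map => -[i b] /=; rewrite negbK.
Qed.

Lemma wcong_catV u : wcong (u ++ winv u) [::].
Proof.
elim: u => [|[i b] u IHu]; first exact: wcong_refl.
have -> : ((i, b) :: u) ++ winv ((i, b) :: u)
          = [:: (i, b)] ++ (u ++ winv u) ++ [:: (i, ~~ b)].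
  by rewrite /winv /= rev_cons -cats1 -!catA.
apply: wcong_trans (wcong_cancel i b).
apply: (@wcong_cat [:: (i, b)] [:: (i, b)] _ [:: (i, ~~ b)]).
  exact: wcong_refl.
apply: (@wcong_cat _ [::]) => //; exact: wcong_refl.
Qed.

Lemma wcong_Vcat u : wcong (winv u ++ u) [::].
Proof. by rewrite -{2}[u]winvK; exact: wcong_catV. Qed.

Lemma wcong_inv u v : wcong u v -> wcong (winv u) (winv v).
Proof.
move=> uv; rewrite -[winv u]cats0.
apply: (@wcong_trans _ (winv u ++ (v ++ winv v))).
  by apply: wcong_cat; [exact: wcong_refl | exact/wcong_sym/wcong_catV].
rewrite catA; apply: (@wcong_cat _ [::]); last exact: wcong_refl.
apply: wcong_trans (wcong_Vcat u).
by apply: wcong_cat; [exact: wcong_refl | exact: wcong_sym].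
Qed.

Definition pg_one : presented_group := \pi_presented_group [::].

Definition pg_mul (x y : presented_group) : presented_group :=
  \pi_presented_group (repr x ++ repr y).

Definition pg_inv (x : presented_group) : presented_group :=
  \pi_presented_group (winv (repr x)).

Lemma pg_mul_pi u v :
  pg_mul (\pi_presented_group u) (\pi_presented_group v)
  = \pi_presented_group (u ++ v).
Proof. by apply/wpiP/wcong_cat; exact: wcong_repr. Qed.

Lemma pg_inv_pi u :
  pg_inv (\pi_presented_group u) = \pi_presented_group (winv u).
Proof. by apply/wpiP/wcong_inv; exact: wcong_repr. Qed.

Lemma pg_mulA : associative pg_mul.
Proof.
elim/quotW => x; elim/quotW => y; elim/quotW => z.
by rewrite (pg_mul_pi y z) (pg_mul_pi x y) !pg_mul_pi catA.
Qed.

Lemma pg_mul1 : left_id pg_one pg_mul.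
Proof. by move=> x; rewrite -[x]reprK pg_mul_pi. Qed.

Lemma pg_mulr1 : right_id pg_one pg_mul.
Proof. by move=> x; rewrite -[x]reprK pg_mul_pi cats0. Qed.

Lemma pg_mulV : left_inverse pg_one pg_inv pg_mul.
Proof.
move=> x; rewrite -[x]reprK pg_inv_pi pg_mul_pi.
exact/wpiP/wcong_Vcat.
Qed.

Lemma pg_mulrV : right_inverse pg_one pg_inv pg_mul.
Proof.
move=> x; rewrite -[x]reprK pg_inv_pi pg_mul_pi.
exact/wpiP/wcong_catV.
Qed.

HB.instance Definition _ :=
  isGroup.Build presented_group pg_mulA pg_mul1 pg_mulr1 pg_mulV pg_mulrV.

End PresentedGroup.

(* The generators $\sigma_1,\dots,\sigma_{n-1}$ are indexed from 0 by
   ['I_n.-1], the strand positions by ['I_n]. *)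
Inductive braid_rel (n : nat) : word 'I_n.-1 -> word 'I_n.-1 -> Prop :=
| BraidYB (i j : 'I_n.-1) : j = i.+1 :> nat ->
    braid_rel [:: (i, true); (j, true); (i, true)]
              [:: (j, true); (i, true); (j, true)]
| BraidComm (i j : 'I_n.-1) : (i.+1 < j)%N ->
    braid_rel [:: (i, true); (j, true)] [:: (j, true); (i, true)].

Definition braid_group (n : nat) : groupType := presented_group (@braid_rel n).

Section BraidClosure.
Variables (n : nat) (w : word 'I_n.-1).

Definition left_pos (i : 'I_n.-1) : 'I_n :=
  Ordinal (ltnW (etrans (esym (ltn_predRL i n)) (ltn_ord i))).

Definition right_pos (i : 'I_n.-1) : 'I_n :=
  Ordinal (etrans (esym (ltn_predRL i n)) (ltn_ord i)).

(* A word is read from top to bottom: the [k]-th letter is the crossing between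
   level [k] and level [k.+1].  Hence a segment is a pair of a position and a
   level in $\{0,\dots,\mathtt{size}\,w\}$. *)
Notation segment := ('I_n * 'I_(size w).+1)%type.

Definition letter (k : 'I_(size w)) : 'I_n.-1 * bool := tnth (in_tuple w) k.

Definition above (k : 'I_(size w)) : 'I_(size w).+1 :=
  widen_ord (leqnSn (size w)) k.

Definition below (k : 'I_(size w)) : 'I_(size w).+1 := lift ord0 k.

(* In $\sigma_i$ the strand starting at the top left passes over, and in
   $\sigma_i^{-1}$ the one starting at the top right. *)
Definition over_top (k : 'I_(size w)) : 'I_n :=
  if (letter k).2 then left_pos (letter k).1 else right_pos (letter k).1.

Definition under_top (k : 'I_(size w)) : 'I_n :=
  if (letter k).2 then right_pos (letter k).1 else left_pos (letter k).1.

(* The segment [y] continues [x] downwards within the same arc: either across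
   a crossing, not as its under-strand, or along a closing strand from the
   bottom to the top. *)
Definition continues (x y : segment) : bool :=
  [exists k : 'I_(size w),
    [&& x.2 == above k, y.2 == below k, x.1 != under_top k
      & y.1 == tperm (left_pos (letter k).1) (right_pos (letter k).1) x.1]]
  || [&& x.2 == ord_max, y.2 == ord0 & y.1 == x.1].

Definition joined (x y : segment) : bool := continues x y || continues y x.

Lemma joined_sym : connect_sym joined.
Proof. by apply: sym_connect_sym => x y; rewrite /joined orbC. Qed.

(* An arc is a connected component of segments, represented by its root. *)
Definition closure_arc : finType := {x : segment | fingraph.roots joined x}.

Definition arc_of (x : segment) : closure_arc :=
  exist _ (fingraph.root joined x) (fingraph.roots_root joined_sym x).

Definition braid_closure : link_diagram := {|
  arcs := closure_arc;
  crossings := 'I_(size w);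
  under_in := fun k => arc_of (under_top k, above k);
  under_out := fun k => arc_of (over_top k, below k);
  over := fun k => arc_of (over_top k, above k);
  positive := fun k => (letter k).2
|}.

End BraidClosure.

(* [repr s] is some word representing the braid [s]; up to isomorphism the
   fundamental quandle of the closure does not depend on it.  The sets counted
   are finite because $Q$ is finite and there are finitely many arcs. *)
Definition col_count (Q : finQuandleType) (n : nat) (s : braid_group n) : nat :=
  (#|` fset_set (Col Q (braid_closure (repr s)))|)%fset.

Definition col_dom_count (Q : finQuandleType) (n : nat) (s : braid_group n) :
    nat :=
  (#|` fset_set (Col_dom Q (braid_closure (repr s)))|)%fset.

Local Open Scope group_scope.

Record finite_index_normal (G : groupType) := FiniteIndexNormal {
  fin_set :> set G;
  fin1 : fin_set 1;
  finM : forall x y, fin_set x -> fin_set y -> fin_set (x * y);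
  finV : forall x, fin_set x -> fin_set x^-1;
  finJ : forall x y, fin_set x -> fin_set (x ^ y);
  fin_finite : finite_set (range (fun x => [set y | fin_set (x^-1 * y)]))
}.

Section FiniteQuotient.
Variables (G : groupType) (N : finite_index_normal G).
Implicit Types x y z : G.

Definition cosetb x y : bool := `[< fin_set N (x^-1 * y) >].

Lemma cosetb_refl : reflexive cosetb.
Proof. by move=> x; apply/asboolP; rewrite mulVg; exact: fin1. Qed.

Lemma cosetb_sym : symmetric cosetb.
Proof.
have H x y : cosetb x y -> cosetb y x.
  by move=> /asboolP/finV; rewrite invgM invgK => ?; apply/asboolP.
by move=> x y; apply/idP/idP; exact: H.
Qed.

Lemma cosetb_trans : transitive cosetb.
Proof.
move=> y x z /asboolP xy /asboolP yz; apply/asboolP.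
by have := finM xy yz; rewrite -mulgA mulVKg.
Qed.

Canonical coset_equiv := EquivRel cosetb cosetb_refl cosetb_sym cosetb_trans.

Definition quotient_group : Type := {eq_quot coset_equiv}.

HB.instance Definition _ := Choice.on quotient_group.
HB.instance Definition _ := EqQuotient.on quotient_group.

Lemma cpiP x y :
  \pi_quotient_group x = \pi_quotient_group y <-> fin_set N (x^-1 * y).
Proof. by split=> [/eqmodP/asboolP //|st]; apply/eqmodP/asboolP. Qed.

Lemma coset_repr x : fin_set N ((repr (\pi_quotient_group x))^-1 * x).
Proof. by apply/cpiP; rewrite reprK. Qed.

Definition qg_mul (a b : quotient_group) : quotient_group :=
  \pi_quotient_group (repr a * repr b).

Definition qg_inv (a : quotient_group) : quotient_group :=
  \pi_quotient_group (repr a)^-1.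

Definition qg_one : quotient_group := \pi_quotient_group 1.

Lemma qg_mul_pi x y :
  qg_mul (\pi_quotient_group x) (\pi_quotient_group y)
  = \pi_quotient_group (x * y).
Proof.
apply/cpiP.
set x' := repr _; set y' := repr _.
have -> : (x' * y')^-1 * (x * y) = (x'^-1 * x) ^ y' * (y'^-1 * y).
  by rewrite /conjg invgM !mulgA mulgK.
by apply: finM; [apply: finJ |]; exact: coset_repr.
Qed.

Lemma qg_inv_pi x : qg_inv (\pi_quotient_group x) = \pi_quotient_group x^-1.
Proof.
apply/cpiP; rewrite invgK; set x' := repr _.
have -> : x' * x^-1 = ((x'^-1 * x)^-1) ^ x'^-1.
  by rewrite /conjg invgM !invgK !mulgA mulgK.
by apply/finJ/finV/coset_repr.
Qed.

Lemma qg_mulA : associative qg_mul.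
Proof.
elim/quotW => x; elim/quotW => y; elim/quotW => z.
by rewrite (qg_mul_pi y z) (qg_mul_pi x y) !qg_mul_pi mulgA.
Qed.

Lemma qg_mul1 : left_id qg_one qg_mul.
Proof. by move=> a; rewrite -[a]reprK qg_mul_pi mul1g. Qed.

Lemma qg_mulr1 : right_id qg_one qg_mul.
Proof. by move=> a; rewrite -[a]reprK qg_mul_pi mulg1. Qed.

Lemma qg_mulV : left_inverse qg_one qg_inv qg_mul.
Proof. by move=> a; rewrite -[a]reprK qg_inv_pi qg_mul_pi mulVg. Qed.

Lemma qg_mulrV : right_inverse qg_one qg_inv qg_mul.
Proof. by move=> a; rewrite -[a]reprK qg_inv_pi qg_mul_pi mulgV. Qed.

HB.instance Definition _ :=
  isGroup.Build quotient_group qg_mulA qg_mul1 qg_mulr1 qg_mulV qg_mulrV.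

End FiniteQuotient.

(* The inverse limit of the finite quotients $G/N$ inside their product:
   [x] is coherent if $G/N \to G/M$ maps $x_N$ to $x_M$ whenever
   $N \subseteq M$. *)
Definition coherent (G : groupType)
    (x : forall N : finite_index_normal G, quotient_group N) : Prop :=
  forall N M : finite_index_normal G, fin_set N `<=` fin_set M ->
  forall g : G, x N = \pi_(quotient_group N) g ->
                x M = \pi_(quotient_group M) g.

Record profinite_completion (G : groupType) := ProfiniteCompletion {
  component : forall N : finite_index_normal G, quotient_group N;
  componentP : coherent component
}.

Section ProfiniteCompletion.
Variable G : groupType.
Notation Ghat := (profinite_completion G).
Implicit Types x y z : Ghat.

HB.instance Definition _ := gen_eqMixin Ghat.
HB.instance Definition _ := gen_choiceMixin Ghat.

Lemma component_inj : injective (@component G).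
Proof.
move=> [x xP] [y yP] /= xy; rewrite -{}xy in yP *.
by congr ProfiniteCompletion; exact: Prop_irrelevance.
Qed.

Lemma coherent_one : coherent (fun N : finite_index_normal G => 1 : quotient_group N).
Proof. by move=> N M NM g /cpiP /NM ?; apply/cpiP. Qed.

Lemma coherent_mul x y : coherent (fun N => component x N * component y N).
Proof.
move=> N M NM g; set a := repr (component x N); set b := repr (component y N).
have xN : component x N = \pi a by rewrite reprK.
have yN : component y N = \pi b by rewrite reprK.
rewrite (componentP NM xN) (componentP NM yN) xN yN.
rewrite [LHS]qg_mul_pi => /cpiP /NM abg.
by rewrite [LHS]qg_mul_pi; apply/cpiP.
Qed.

Lemma coherent_inv x : coherent (fun N => (component x N)^-1).
Proof.
move=> N M NM g; set a := repr (component x N).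
have xN : component x N = \pi a by rewrite reprK.
rewrite (componentP NM xN) xN [LHS]qg_inv_pi => /cpiP /NM ag.
by rewrite [LHS]qg_inv_pi; apply/cpiP.
Qed.

Definition pc_one : Ghat := ProfiniteCompletion coherent_one.
Definition pc_mul x y : Ghat := ProfiniteCompletion (@coherent_mul x y).
Definition pc_inv x : Ghat := ProfiniteCompletion (@coherent_inv x).

Lemma pc_mulA : associative pc_mul.
Proof.
by move=> x y z; apply/component_inj/functional_extensionality_dep => N /=;
  rewrite mulgA.
Qed.

Lemma pc_mul1 : left_id pc_one pc_mul.
Proof.
by move=> x; apply/component_inj/functional_extensionality_dep => N /=;
  rewrite mul1g.
Qed.

Lemma pc_mulr1 : right_id pc_one pc_mul.
Proof.
by move=> x; apply/component_inj/functional_extensionality_dep => N /=;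
  rewrite mulg1.
Qed.

Lemma pc_mulV : left_inverse pc_one pc_inv pc_mul.
Proof.
by move=> x; apply/component_inj/functional_extensionality_dep => N /=;
  rewrite mulVg.
Qed.

Lemma pc_mulrV : right_inverse pc_one pc_inv pc_mul.
Proof.
by move=> x; apply/component_inj/functional_extensionality_dep => N /=;
  rewrite mulgV.
Qed.

HB.instance Definition _ :=
  isGroup.Build Ghat pc_mulA pc_mul1 pc_mulr1 pc_mulV pc_mulrV.

HB.instance Definition _ := isPointed.Build Ghat 1.

(* The subspace topology of the product of the discrete groups $G/N$. *)
Definition to_product (x : Ghat) :
    prod_topology (fun N : finite_index_normal G =>
                     discrete_topology (quotient_group N)) :=
  component x.

HB.instance Definition _ :=
  Topological.copy Ghat (initial_topology to_product).

Lemma coherent_pi (g : G) :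
  coherent (fun N : finite_index_normal G => \pi_(quotient_group N) g).
Proof. by move=> N M NM h /cpiP /NM ?; apply/cpiP. Qed.

Definition to_completion (g : G) : Ghat := ProfiniteCompletion (@coherent_pi g).

(* The continuous extension of [f] along $G \to \widehat G$, where [nat] is
   discrete; it is unique since $G$ has dense image, and it exists when [f]
   factors through a finite quotient of $G$. *)
Definition continuous_extension (f : G -> nat) : Ghat -> nat :=
  get [set c : Ghat -> nat | continuous c /\
                             forall g, c (to_completion g) = f g].

Definition borel_completion := g_sigma_algebraType (@open Ghat).

HB.instance Definition _ := Measurable.on borel_completion.

End ProfiniteCompletion.

(* No regularity condition is needed: for $G = B_n$, which is finitely
   generated, $\widehat G$ is compact metrizable, so every Borel probability
   measure is regular and the left invariant one is unique. *)
Definition is_haar (R : realType) (G : groupType)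
    (mu : probability (borel_completion G) R) : Prop :=
  forall (g : profinite_completion G) (A : set (borel_completion G)),
    measurable A ->
    mu [set (g * (x : profinite_completion G) : borel_completion G) | x in A]
    = mu A.

Local Close Scope group_scope.
Local Open Scope ring_scope.

Definition c_ (Q : finQuandleType) (n : nat) :
    profinite_completion (braid_group n) -> nat :=
  continuous_extension (@col_count Q n).

Definition c_dom (Q : finQuandleType) (n : nat) :
    profinite_completion (braid_group n) -> nat :=
  continuous_extension (@col_dom_count Q n).

Definition integer_valued (P : {poly rat}) : Prop :=
  forall z : int, P.[z%:~R] \is a Num.int.

(* Main.v *)
From mathcomp Require Import all_boot all_order all_algebra all_fingroup finmap.
From mathcomp Require Import all_classical all_reals all_analysis.
From mathcomp Require Import measurable_realfun ring zify.
Require Import Defs.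

(** By Haar invariance the integral is the average of the number of fixed
    points over the finite image of [B_n] in the permutations of [Q^n], hence
    by Burnside's lemma the number of [B_n]-orbits on [Q^n] (on generating
    tuples, in the dominant case).  Orbits are the elements of length [n] of the
    structure monoid of [Q], with relations [x y = (x |> y) x]; each
    [x] in [Q] satisfies [x M = M x] there, so every element is
    [x_1 ^ j_1 ... x_d ^ j_d] where [Q = {x_1, ..., x_d}].  Taking the
    lexicographically largest exponent [j] gives a normal form, and the
    exponents that are not normal form an upward closed subset of [N^d].  The
    number of points of degree [n] outside such a subset is eventually
    polynomial in [n]. *)

Set Implicit Arguments.
Unset Strict Implicit.
Unset Printing Implicit Defensive.

Import Order.TTheory GRing.Theory Num.Theory.

(** * Upward closed sets of exponents *)

(** Among sequences of equal length this is closure under the componentwise order, which unit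
    increments of one entry generate. *)
Definition upclosed (T : seq nat -> Prop) : Prop :=
  forall s1 a s2, T (s1 ++ a :: s2) -> T (s1 ++ a.+1 :: s2).

Lemma upclosed_cons (T : seq nat -> Prop) k :
  upclosed T -> upclosed (fun s => T (k :: s)).
Proof. by move=> upT s1 a s2; apply: (upT (k :: s1)). Qed.

Lemma upclosed_head (T : seq nat -> Prop) k l s :
  upclosed T -> (k <= l)%N -> T (k :: s) -> T (l :: s).
Proof.
move=> upT /subnK <-; elim: (l - k)%N => [//|m IH] /IH.
exact: (upT [::]).
Qed.

(* Induction on [d]: the diagonal slices [T k (k :: _)] stabilise, at [m] say,
   so all slices beyond [m] agree, and only finitely many remain. *)
Lemma upclosed_chain_stable d (T : nat -> seq nat -> Prop) :
  (forall k, upclosed (T k)) -> (forall k s, T k s -> T k.+1 s) ->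
  exists m, forall k s, (m <= k)%N -> size s = d -> T k s -> T m s.
Proof.
elim: d T => [|d IHd] T upT incT.
  have [[m Tm]|noT] := pselect (exists m, T m [::]).
    by exists m => k s _ /size0nil ->.
  by exists 0 => k s _ /size0nil -> Tk; case: noT; exists k.
have monoT k l s : (k <= l)%N -> T k s -> T l s.
  by move=> /subnK <-; elim: (l - k)%N => [//|i IH] /IH; apply: incT.
have [|k s Tk|m0 diag] := IHd (fun k s => T k (k :: s)).
- by move=> k; apply: upclosed_cons.
- exact/incT/(upclosed_head _ (leqnSn k)).
have slices l : exists m, forall k, (m <= k)%N -> forall s, size s = d ->
    T k (l :: s) -> T m (l :: s).
  have [||m Hm] := IHd (fun k s => T k (l :: s)).
  - by move=> k; apply: upclosed_cons.
  - by move=> k s; apply: incT.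
  by exists m => k lemk s; apply: Hm.
have [f Hf] := choice slices.
exists (maxn m0 (\max_(l < m0) f l)) => k [//|l s] lek [size_s] Tk.
have [ltl|lel] := ltnP l m0.
  apply: (monoT (f l)).
    by rewrite leq_max (@leq_bigmax _ (fun l : 'I_m0 => f l) (Ordinal ltl)) orbT.
  apply: (Hf l k) => //; apply: leq_trans lek.
  by rewrite leq_max (@leq_bigmax _ (fun l : 'I_m0 => f l) (Ordinal ltl)) orbT.
(* For a head [l >= m0]: raise stage and head to [maxn k l], descend along the diagonal to [m0],
   then raise the head to [l] again. *)
apply: (monoT m0); first by rewrite leq_maxl.
apply: (upclosed_head _ lel) => //.
apply: (diag (maxn k l)) => //; first by rewrite leq_max lel orbT.
apply: (@upclosed_head _ l _ _ (upT _)); first exact: leq_maxr.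
by apply: monoT Tk; apply: leq_maxl.
Qed.

(** Weak compositions, the exponents of the monomials of degree [n] in [d] variables; without
    variables there is one, for [n = 0] only. *)
Fixpoint compositions d n : seq (seq nat) :=
  if d is d'.+1 then
    flatten [seq map (cons k) (compositions d' (n - k)) | k <- iota 0 n.+1]
  else nseq (n == 0) [::].

Lemma compositionsS d n : compositions d.+1 n =
  flatten [seq map (cons k) (compositions d (n - k)) | k <- iota 0 n.+1].
Proof. by []. Qed.

Lemma mem_compositions d n s :
  (s \in compositions d n) = (size s == d) && (sumn s == n).
Proof.
elim: d n s => [|d IHd] n s.
  rewrite /= mem_nseq lt0b; case: s => [|a s] /=; last by rewrite andbF.
  by rewrite andbT eq_sym.
have memr k : (k \in iota 0 n.+1) = (k <= n) by rewrite mem_iota add0n ltnS.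
rewrite compositionsS; move: (iota 0 n.+1) memr => r memr.
apply/flatten_mapP/andP => [[k]|].
  rewrite memr => lekn /mapP[t]; rewrite IHd.
  by case/andP=> /eqP <- /eqP tn ->; rewrite /= eqxx tn subnKC.
case: s => [[]//|k s] [/eqP[size_s] /eqP /= sum_s].
exists k; first by rewrite memr -sum_s leq_addr.
by rewrite map_f // IHd size_s -sum_s addKn !eqxx.
Qed.

Lemma compositions_uniq d n : uniq (compositions d n).
Proof.
elim: d n => [|d IHd] n; first by case: n.
rewrite compositionsS; apply: (@allpairs_uniq_dep _ _ _ (fun k s => k :: s)).
- exact: iota_uniq.
- by move=> k _; apply: IHd.
- by move=> [a s] [b t] _ _ /= [-> ->].
Qed.

(** * Counting functions that are eventually polynomial *)

Section EventuallyPolynomial.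
Local Open Scope ring_scope.

(** For upward closed [T], this is the Hilbert function of the quotient by the monomial ideal with
    exponents in [T]. *)
Definition avoiding (T : seq nat -> Prop) d n : nat :=
  count (fun s => ~~ `[< T s >]) (compositions d n).

Lemma avoidingS T d n :
  avoiding T d.+1 n = (\sum_(k < n.+1) avoiding (fun s => T (val k :: s)) d (n - k))%N.
Proof.
rewrite /avoiding compositionsS count_flatten -map_comp sumnE big_map.
rewrite -[iota 0 n.+1]/(index_iota 0 n.+1) big_mkord.
by apply: eq_bigr => k _ /=; rewrite count_map.
Qed.

(** Values lie in [int] because differences of counts are formed. *)
Definition eventually_poly (h : nat -> int) : Prop :=
  exists (P : {poly rat}) (n0 : nat), integer_valued P /\
    forall n, (n0 <= n)%N -> (h n)%:~R = P.[n%:R].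

Lemma eventually_polyD f g :
  eventually_poly f -> eventually_poly g ->
  eventually_poly (fun n => f n + g n).
Proof.
move=> [P [m [Pint fP]]] [P' [m' [P'int gP]]].
exists (P + P'), (maxn m m'); split=> [z|n].
  by rewrite hornerD rpredD.
by rewrite geq_max => /andP[??]; rewrite hornerD rmorphD /= fP // gP.
Qed.

Lemma eventually_polyN f :
  eventually_poly f -> eventually_poly (fun n => - f n).
Proof.
move=> [P [m [Pint fP]]]; exists (- P), m; split=> [z|n mn].
  by rewrite hornerN rpredN.
by rewrite hornerN rmorphN /= fP.
Qed.

Lemma eventually_poly_shift f k :
  eventually_poly f -> eventually_poly (fun n => f (n - k)%N).
Proof.
(* From [m + k] on, [n - k] is a true subtraction and lies in the range where [f] agrees with
   [P]. *)
move=> [P [m [Pint fP]]]; exists (P \Po ('X - k%:R%:P)), (m + k)%N; split=> [z|n mn].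
  by rewrite horner_comp !hornerE -[k%:R]/(k%:~R) -rmorphB /=; apply: Pint.
have kn : (k <= n)%N by apply: leq_trans mn; rewrite leq_addl.
by rewrite horner_comp !hornerE fP ?natrB // leq_subRL // addnC.
Qed.

Lemma eventually_poly_sum (I : Type) (r : seq I) (f : I -> nat -> int) :
  (forall i, eventually_poly (f i)) ->
  eventually_poly (fun n => \sum_(i <- r) f i n).
Proof.
move=> Hf; elim: r => [|i r IHr].
  by exists 0, 0; split=> [z|n _]; rewrite ?big_nil horner0.
have [P [m [Pint fP]]] := eventually_polyD (Hf i) IHr.
by exists P, m; split=> // n mn; rewrite big_cons fP.
Qed.

Lemma eventually_poly_eq f g m :
  (forall n, (m <= n)%N -> f n = g n) -> eventually_poly f -> eventually_poly g.
Proof.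
move=> fg [P [m' [Pint fP]]]; exists P, (maxn m m'); split=> // n.
by rewrite geq_max => /andP[mn m'n]; rewrite -fg // fP.
Qed.

Lemma eventually_polyS f :
  eventually_poly f -> eventually_poly (fun n => f n.+1).
Proof.
move=> [P [m [Pint fP]]]; exists (P \Po ('X + 1%:P)), m; split=> [z|n mn].
  by rewrite horner_comp !hornerE -[1]/(1%:~R) -rmorphD /=; apply: Pint.
by rewrite horner_comp !hornerE fP ?leqW // -natr1.
Qed.

(** Expanding [(x + 1) ^+ k.+1 - x ^+ k.+1] gives [k.+1%:R * x ^+ k] plus lower monomials, whose
    antidifferences are already known and are subtracted. *)
Lemma antidifference_monomials k :
  exists F : nat -> {poly rat}, forall i, (i < k)%N ->
    forall x, (F i).[x + 1] - (F i).[x] = x ^+ i.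
Proof.
elim: k => [|k [F HF]]; first by exists (fun=> 0).
pose Fk := k.+1%:R^-1 *: ('X^(k.+1) - \sum_(i < k) 'C(k.+1, i)%:R *: F i).
exists (fun i => if i == k then Fk else F i) => i; rewrite ltnS leq_eqVlt.
case: eqVneq => [-> _ x|ne /= ltik x]; last exact: HF.
pose B y := \sum_(i < k) 'C(k.+1, i)%:R * (F i).[y].
have FkE y : Fk.[y] = k.+1%:R^-1 * (y ^+ k.+1 - B y).
  rewrite !hornerE horner_sum; congr (_ * (_ - _)).
  by apply: eq_bigr => j _; rewrite hornerZ.
have dB : B (x + 1) = B x + \sum_(i < k) x ^+ i *+ 'C(k.+1, i).
  rewrite -big_split /=; apply: eq_bigr => j _.
  by rewrite -(mulr_natl (x ^+ j)) -[x ^+ j]HF // -mulrDr subrKC.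
rewrite !FkE -mulrBr exprD1n 2!big_ord_recr /= binn mulr1n binSn dB.
rewrite -(mulr_natl (x ^+ k)).
apply: (canLR (mulKf _)); first by rewrite pnatr_eq0.
by ring.
Qed.

Lemma antidifference (P : {poly rat}) :
  exists S : {poly rat}, forall x, S.[x + 1] - S.[x] = P.[x].
Proof.
have [F HF] := antidifference_monomials (size P).
exists (\sum_(i < size P) P`_i *: F i) => x.
rewrite [RHS]horner_coef !horner_sum -sumrB; apply: eq_bigr => i _.
by rewrite !hornerE -mulrBr HF.
Qed.

(* An antidifference of an integer-valued polynomial is integer-valued as
   soon as one of its values at an integer is an integer. *)
Lemma eventually_poly_sumr h :
  eventually_poly (fun n => h n.+1 - h n) -> eventually_poly h.
Proof.
move=> [P [m [Pint hP]]]; have [S HS] := antidifference P.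
pose q := S + ((h m)%:~R - S.[m%:R])%:P.
have qE x : q.[x] = S.[x] + ((h m)%:~R - S.[m%:R]) by rewrite hornerD hornerC.
have qm : q.[m%:R] = (h m)%:~R by rewrite qE subrKC.
have dq x : q.[x + 1] = q.[x] + P.[x].
  by rewrite -HS !qE addrAC subrKC.
exists q, m; split=> [z|n mn].
  (* The recursion [dq] carries integrality from [m] upwards and, read backwards, downwards. *)
  rewrite -[z](subrK m%:Z) addrC; case: (z - m%:Z) => k.
    elim: k => [|k IHk]; first by rewrite addr0 qm.
    rewrite -addn1 PoszD addrA rmorphD /= dq rpredD //; exact: Pint.
  have -> : Negz k = - k.+1%:Z by [].
  elim: k.+1 => [|l IHl]; first by rewrite subr0 qm.
  rewrite -[q.[_]](addrK P.[(m%:Z - l.+1%:Z)%:~R]) -dq rpredB //.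
  have -> // : (m%:Z - l.+1%:Z)%:~R + 1 = (m%:Z - l%:Z)%:~R :> rat.
  by rewrite -[1]/(1%:~R) -rmorphD /= -addn1 PoszD opprD addrA subrK.
rewrite -(subnK mn); elim: (n - m)%N => [|k IHk]; first by rewrite qm.
rewrite addSn -natr1 dq -IHk -hP ?leq_addl // -rmorphD /=.
by rewrite addrC subrK.
Qed.

(** Induction on [d], applied to the difference in [n]. With exponents sorted by their first entry,
    slice [k.+1] in degree [n.+1] is paired with slice [k] in degree [n]: both leave degree [n - k].
    Slices agree from some [m] on, so only slice [0] and the differences with [k < m] remain. *)
Lemma avoiding_poly d T :
  upclosed T -> eventually_poly (fun n => (avoiding T d n)%:Z).
Proof.
elim: d T => [|d IHd] T upT.
  (* The empty sequence has degree 0, so the count vanishes from [n = 1] on. *)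
  by exists 0, 1%N; split=> [z|[//|n] _]; rewrite horner0.
apply: eventually_poly_sumr.
have [||m stab] := @upclosed_chain_stable d (fun k s => T (k :: s)).
- by move=> k; apply: upclosed_cons.
- by move=> k s; apply: (upT [::]).
pose g k n := (avoiding (fun s => T (k.+1 :: s)) d n)%:Z
            - (avoiding (fun s => T (k :: s)) d n)%:Z.
have g0 k n : (m <= k)%N -> g k n = 0.
  move=> mk; apply/eqP; rewrite subr_eq0; apply/eqP; congr Posz.
  apply: eq_in_count => s; rewrite mem_compositions => /andP[/eqP size_s _].
  congr (~~ _); apply/asboolP/asboolP => Ts; last exact: (upT [::]).
  by apply: (upclosed_head _ mk) => //; apply: stab Ts => //; apply: leqW.
apply: (@eventually_poly_eq (fun n : nat =>
  (avoiding (fun s => T (0%N :: s)) d (n.+1))%:Z + \sum_(0 <= k < m) g k (n - k)%N) _ m).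
  move=> n mn; rewrite !avoidingS big_ord_recl /= subn0 !PoszD -addrA; congr (_ + _).
  rewrite big_mkord.
  rewrite !(big_morph Posz PoszD (erefl _)) -sumrB.
  rewrite (big_ord_widen n.+1 (fun k => g k (n - k)%N) (leqW mn)) big_mkcond.
  by apply: eq_bigr => k _; case: ltnP => [//|/g0 gk]; apply: esym (gk (n - k)%N).
apply: eventually_polyD.
  apply: (@eventually_polyS (fun n => (avoiding (fun s => T (0%N :: s)) d n)%:Z)).
  by apply: IHd; apply: (@upclosed_cons T 0%N).
apply: eventually_poly_sum => k.
apply: (@eventually_poly_shift (g k)).
apply: eventually_polyD.
  by apply: IHd; apply: (@upclosed_cons T k.+1).
by apply: eventually_polyN; apply: IHd; apply: (@upclosed_cons T k).
Qed.

End EventuallyPolynomial.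

(** * Hurwitz equivalence of words *)

(** Used to locate an incremented exponent relative to the place where reducibility is witnessed. *)
Lemma cat_cons_cases (T : Type) (j1 : seq T) a j2 s1 b s2 :
  j1 ++ a :: j2 = s1 ++ b :: s2 ->
  [\/ [/\ j1 = s1, a = b & j2 = s2],
      exists t, j1 = s1 ++ b :: t /\ s2 = t ++ a :: j2
    | exists t, s1 = j1 ++ a :: t /\ j2 = t ++ b :: s2].
Proof.
elim: j1 s1 => [|c j1 IH] [|d s1] /= [].
- by move=> -> ->; apply: Or31.
- by move=> -> ->; apply: Or33; exists s1.
- by move=> -> <-; apply: Or32; exists j1.
- move=> -> /IH[[-> -> ->]|[t [-> ->]]|[t [-> ->]]].
  + exact: Or31.
  + by apply: Or32; exists t.
  + by apply: Or33; exists t.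
Qed.

Section Words.
Variable Q : finQuandleType.
Implicit Types (x y z : Q) (s t u v w r xs : seq Q) (j : seq nat).

(** [qop_bij] hides the inverse in a proposition; finiteness of [Q] supplies it as a function. *)
Definition qdiv x : Q -> Q := invF (bij_inj (qop_bij x)).

Lemma qopK x : cancel (qop x) (qdiv x). Proof. exact: invF_f. Qed.
Lemma qdivK x : cancel (qdiv x) (qop x). Proof. exact: f_invF. Qed.

(** Equality of words in the structure monoid of [Q]; the context built into a step makes it a
    congruence. *)
Inductive hurwitz : seq Q -> seq Q -> Prop :=
| hurwitz_step s x y t :
    hurwitz (s ++ [:: x, y & t]) (s ++ [:: qop x y, x & t])
| hurwitz_refl s : hurwitz s s
| hurwitz_sym s t : hurwitz s t -> hurwitz t s
| hurwitz_trans s t u : hurwitz s t -> hurwitz t u -> hurwitz s u.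

Lemma hurwitz_cat u v s t : hurwitz s t -> hurwitz (u ++ s ++ v) (u ++ t ++ v).
Proof.
elim=> {s t} [s x y t|s|s t _|s t r _ IH1 _].
- by rewrite -!catA !cat_cons !(catA u); apply: hurwitz_step.
- exact: hurwitz_refl.
- exact: hurwitz_sym.
- exact: hurwitz_trans.
Qed.

Lemma hurwitz_catl u s t : hurwitz s t -> hurwitz (u ++ s) (u ++ t).
Proof. by move=> st; have := hurwitz_cat u [::] st; rewrite !cats0. Qed.

Lemma hurwitz_size s t : hurwitz s t -> size s = size t.
Proof.
by elim=> {s t} [s x y t|//|//|s t u _ -> _ //]; rewrite !size_cat.
Qed.

Lemma hurwitz_swap x y t : hurwitz [:: x, y & t] [:: qop x y, x & t].
Proof. exact: (hurwitz_step [::]). Qed.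

Lemma hurwitz_push y w r : exists z, hurwitz (y :: w ++ r) (w ++ z :: r).
Proof.
elim: w y => [|x w IHw] y; first by exists y; apply: hurwitz_refl.
have [z Hz] := IHw (qdiv x y); exists z.
apply: hurwitz_trans (hurwitz_catl [:: x] Hz).
by apply: hurwitz_sym; have := hurwitz_swap x (qdiv x y) (w ++ r); rewrite qdivK.
Qed.

(** [z] is chosen before [r], so a letter pulled out of one word can be put back into another with
    the same prefix [w]. *)
Lemma hurwitz_pull w x : exists z, forall r, hurwitz (w ++ x :: r) (z :: w ++ r).
Proof.
elim: w => [|y w [z Hz]]; first by exists x => r; apply: hurwitz_refl.
exists (qop y z) => r; apply: hurwitz_trans (hurwitz_swap y z (w ++ r)).
exact: (hurwitz_catl [:: y] (Hz r)).
Qed.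

(** Here [x] itself survives and the letters it crosses change, since [y x = x (qdiv x y)]. In the
    structure monoid [M], this puts [M x] inside [x M]. *)
Lemma hurwitz_move_front w x r : exists t, hurwitz (w ++ x :: r) (x :: t).
Proof.
elim: w => [|y w [t Ht]]; first by exists r; apply: hurwitz_refl.
exists (qdiv x y :: t).
apply: hurwitz_trans (hurwitz_catl [:: y] Ht) _.
by apply: hurwitz_sym; have := hurwitz_swap x (qdiv x y) t; rewrite qdivK.
Qed.

(** With [j] shorter than [xs] this is a monomial in the first letters only, which lets prefixes of
    an exponent serve as divisors. *)
Fixpoint monomial xs j : seq Q :=
  match xs, j with
  | x :: xs', a :: j' => nseq a x ++ monomial xs' j'
  | _, _ => [::]
  end.

Lemma size_monomial xs j : size j = size xs -> size (monomial xs j) = sumn j.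
Proof.
elim: xs j => [|x xs IH] [|a j] //= [szj].
by rewrite size_cat size_nseq IH.
Qed.

Lemma monomial_split x0 xs j1 a j2 : size j1 < size xs ->
  monomial xs (j1 ++ a :: j2)
  = monomial xs j1 ++ nseq a (nth x0 xs (size j1)) ++
    monomial (drop (size j1).+1 xs) j2.
Proof.
elim: j1 xs => [|b j1 IH] [|x xs] //=; first by rewrite drop0.
by rewrite ltnS => /IH ->; rewrite catA.
Qed.

Lemma monomial_rcons x0 xs j a : size j < size xs ->
  monomial xs (rcons j a) = monomial xs j ++ nseq a (nth x0 xs (size j)).
Proof.
by move=> lt_j; rewrite -cats1 (monomial_split x0) //; case: drop => /=; rewrite cats0.
Qed.

(** * Lexicographic normal form in the structure monoid *)

Section Monomials.
Variable xs : seq Q.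

Definition divides j w : Prop := exists r, hurwitz w (monomial xs j ++ r).

(* [j] is reducible if [monomial xs j] is left divisible in the structure
   monoid of [Q] by a monomial with lexicographically larger exponents. *)
Definition reducible j : Prop :=
  size j = size xs /\
  exists j1 a j2, j = j1 ++ a :: j2 /\ divides (rcons j1 a.+1) (monomial xs j).

(* Inserting a letter [y] after a prefix [u] amounts to prepending the letter
   [z] with [u y = z u], and [z] can be pushed behind any prefix. *)
Lemma reducible_upclosed : upclosed reducible.
Proof.
move=> s1 b s2 [szj [j1 [a [j2 [Ej [r Hr]]]]]].
have lt_s1 : size s1 < size xs.
  by rewrite -szj size_cat /= addnS ltnS leq_addr.
split; first by rewrite -szj !size_cat.
have x0 : Q by case: xs lt_s1.
set y := nth x0 xs (size s1); set v := nseq b y ++ monomial (drop (size s1).+1 xs) s2.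
have [z Hz] := hurwitz_pull (monomial xs s1) y.
have {}Hr : hurwitz (monomial xs (s1 ++ b.+1 :: s2))
                    (z :: monomial xs (rcons j1 a.+1) ++ r).
  rewrite (monomial_split x0) //; apply: hurwitz_trans (Hz v) _.
  by apply: (hurwitz_catl [:: z]); rewrite -(monomial_split x0).
(* If the incremented exponent lies at or before the witness of reducibility, [z] is put back as a
   [y] inside the divisor; if it lies after, the divisor is kept and [z] is pushed behind it. *)
case: (cat_cons_cases Ej) => [[Es1 Eb Es2]|[t [Es1 Es2]]|[t [Ej1 Ej2]]].
- exists s1, b.+1, s2; split=> //; exists r.
  move: Hr; rewrite -Es1 -Eb !(monomial_rcons x0) //= -!catA /= => Hr.
  exact/(hurwitz_trans Hr)/hurwitz_sym/(Hz (y :: _)).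
- exists j1, a, (t ++ b.+1 :: s2); split; first by rewrite Es1 -catA.
  have [z' Hz'] := hurwitz_push z (monomial xs (rcons j1 a.+1)) r.
  by exists (z' :: r); apply: hurwitz_trans Hr Hz'.
- exists (s1 ++ b.+1 :: t), a, j2; split; first by rewrite Ej2 -catA.
  exists r; move: Hr; rewrite Ej1 !rcons_cat !rcons_cons !(monomial_split x0) // => Hr.
  apply: (hurwitz_trans Hr); rewrite -!catA; exact/hurwitz_sym/Hz.
Qed.

Lemma divides_leq j1 a b w : size j1 < size xs -> a <= b ->
  divides (rcons j1 b) w -> divides (rcons j1 a) w.
Proof.
move=> lt_j1 /subnKC <- [r]; have x0 : Q by case: xs lt_j1.
rewrite !(monomial_rcons x0) // nseqD -!catA => Hr.
exists (nseq (b - a) (nth x0 xs (size j1)) ++ r).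
by rewrite (monomial_rcons x0) // -catA.
Qed.

(** At the first place where the exponents differ, the larger entry of one shows up as a divisor of
    the other monomial, which is then reducible. *)
Lemma irreducible_unique j j' :
  size j = size xs -> size j' = size xs -> ~ reducible j -> ~ reducible j' ->
  hurwitz (monomial xs j) (monomial xs j') -> j = j'.
Proof.
have diff (s t : seq nat) : size s = size t -> s != t ->
    exists (s1 : seq nat) a (s2 : seq nat) b (t2 : seq nat),
    [/\ s = s1 ++ a :: s2, t = s1 ++ b :: t2 & a != b].
  elim: s t => [|a s IH] [|b t] //= [st].
  case: (eqVneq a b) => [<-|neab _]; last by exists [::], a, s, b, t.
  rewrite eqseq_cons eqxx /= => /(IH _ st)[s1 [a' [s2 [b' [t2 [-> -> ne]]]]]].
  by exists (a :: s1), a', s2, b', t2.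
move=> szj szj' irrj irrj' jj'; apply/eqP/negPn/negP => ne.
have [s1 [a [s2 [b [t2 [Ej Ej' neab]]]]]] := diff _ _ (etrans szj (esym szj')) ne.
wlog ltab : j j' szj szj' irrj irrj' jj' ne a b s2 t2 Ej Ej' neab / a < b.
  move=> W; move: (neab); rewrite neq_ltn => /orP[lt|lt].
    exact: (W j j' _ _ _ _ _ _ a b s2 t2).
  apply: (W j' j _ _ _ _ (hurwitz_sym jj') _ b a t2 s2) => //.
  - by rewrite eq_sym.
  - by rewrite eq_sym.
have lt_s1 : size s1 < size xs.
  by rewrite -szj Ej size_cat /= addnS ltnS leq_addr.
have x0 : Q by case: xs lt_s1.
apply: irrj; split=> //; exists s1, a, s2; split=> //.
apply: (divides_leq lt_s1 ltab).
exists (monomial (drop (size s1).+1 xs) t2).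
by rewrite (monomial_rcons x0) // -catA -monomial_split // -Ej'.
Qed.

(** Exponents are chosen from left to right, each as large as possible; the length of [w], a Hurwitz
    invariant, bounds them. *)
Lemma divides_greedy w p : p <= size xs -> exists j,
  [/\ size j = p, divides j w & forall j1 a j2, j = j1 ++ a :: j2 ->
     ~ divides (rcons j1 a.+1) w].
Proof.
elim: p => [_|p IHp lt_p].
  exists [::]; split=> //; last by move=> [].
  by exists w; case: xs => [|? ?]; apply: hurwitz_refl.
have [j [szj [r Hr] maxj]] := IHp (ltnW lt_p).
have lt_j : size j < size xs by rewrite szj.
have x0 : Q by case: xs lt_p.
pose D a := `[< divides (rcons j a) w >].
have D0 : D 0 by apply/asboolP; exists r; rewrite (monomial_rcons x0) //= cats0.
have Dle a : D a -> a <= size w.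
  move=> /asboolP[r' /hurwitz_size ->]; rewrite (monomial_rcons x0) //.
  by rewrite -catA !size_cat size_nseq addnCA leq_addr.
have [a /asboolP Da maxa] := ex_maxnP (ex_intro _ 0 D0) Dle.
exists (rcons j a); split=> //; first by rewrite size_rcons szj.
move=> j1 b j2; case/lastP: j2 => [|j2 c].
  rewrite cats1 => /rcons_inj[<- <-] /asboolP Db.
  by have := maxa _ Db; rewrite ltnn.
by rewrite -rcons_cons -rcons_cat => /rcons_inj[Ej _]; apply: maxj Ej.
Qed.

(** If the greedy monomial left a remainder, its first letter, entry [i] of [xs], could be moved
    unchanged past the later blocks to join block [i], against the maximality of that exponent. *)
Lemma irreducible_exists w : (forall x, x \in xs) ->
  exists j, [/\ size j = size xs, ~ reducible j & hurwitz w (monomial xs j)].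
Proof.
move=> xsT; have [j [szj [r Hr] maxj]] := divides_greedy w (leqnn (size xs)).
case: r Hr => [|x r] Hr.
  rewrite cats0 in Hr; exists j; split=> // -[_ [j1 [a [j2 [Ej [r Hr']]]]]].
  by apply: (maxj _ _ _ Ej); exists r; apply: hurwitz_trans Hr Hr'.
pose i := index x xs; have lt_i : i < size xs by rewrite index_mem xsT.
have lt_ij : i < size j by rewrite szj.
have Ej : j = take i j ++ nth 0 j i :: drop i.+1 j.
  by rewrite -drop_nth // cat_take_drop.
have szi : size (take i j) = i by rewrite size_takel // ltnW.
exfalso; apply: (maxj _ _ _ Ej).
move: Hr; rewrite {1}Ej (monomial_split x) szi // nth_index // -!catA => Hr.
have [t Ht] := hurwitz_move_front (monomial (drop i.+1 xs) (drop i.+1 j)) x r.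
exists t; rewrite (monomial_rcons x) szi // nth_index // -catA.
apply: hurwitz_trans Hr _; apply: hurwitz_catl.
rewrite -[(nth 0 j i).+1]addn1 nseqD -catA; exact: hurwitz_catl.
Qed.

End Monomials.

(** The equality of truth values gives closure under [qdiv x] too, so [C] is a subquandle. *)
Definition qclosed (C : {set Q}) : bool :=
  [forall x in C, forall y, (qop x y \in C) == (y \in C)].

Definition generating s : bool :=
  [forall C : {set Q}, (qclosed C && all (mem C) s) ==> (C == [set: Q])].

Lemma qclosedP (C : {set Q}) :
  reflect {in C, forall x y, (qop x y \in C) = (y \in C)} (qclosed C).
Proof.
apply: (iffP forall_inP) => [H x Cx y|H x Cx]; first exact/eqP/(forallP (H x Cx)).
by apply/forallP => y; rewrite H.
Qed.

Lemma hurwitz_closed (C : {set Q}) s t :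
  qclosed C -> hurwitz s t -> all (mem C) s = all (mem C) t.
Proof.
move=> /qclosedP HC; elim=> {s t} [s x y t|//|s t _ -> //|s t u _ -> _ //].
rewrite !all_cat /=; congr (_ && _); rewrite [RHS]andbCA.
case Cx: (x \in C) => //=; congr (_ && _); exact/esym/(HC x Cx).
Qed.

Lemma generating_hurwitz s t : hurwitz s t -> generating s = generating t.
Proof.
move=> st; apply: eq_forallb => C; case CC: (qclosed C) => //=.
by rewrite (hurwitz_closed CC st).
Qed.

Lemma generating_sub s t : {subset s <= t} -> generating s -> generating t.
Proof.
move=> st /forallP Hs; apply/forallP => C; apply/implyP => /andP[CC /allP Ct].
by apply: (implyP (Hs C)); rewrite CC; apply/allP => x /st /Ct.
Qed.

(** Adding letters preserves generation. The union turns the number of irreducible generating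
    exponents into a difference of two [avoiding] counts. *)
Lemma reducible_or_generating_upclosed xs :
  upclosed (fun j => reducible xs j \/ generating (monomial xs j)).
Proof.
move=> s1 a s2 [red|gen]; [left; exact: reducible_upclosed | right].
apply: generating_sub gen => x.
elim: s1 xs => [|b s1 IH] [|y xs] //=; rewrite !mem_cat.
  by rewrite in_cons mem_cat => ->; rewrite orbT.
by move=> /orP[->//|/IH ->]; rewrite orbT.
Qed.

End Words.

(** * The braid action on colorings *)

Section Swap.
Local Open Scope group_scope.
Variables (Q : finQuandleType) (I : finType).
Implicit Types (a b c d : I) (v : {ffun I -> Q}).

(** Colors below a positive crossing: the over-strand carries its color from [a] to [b], while the
    under-strand goes from [b] to [a]. *)
Definition swap a b v : {ffun I -> Q} :=
  [ffun p => if p == a then qop (v a) (v b) else if p == b then v a else v p].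

Definition unswap a b v : {ffun I -> Q} :=
  [ffun p => if p == a then v b else if p == b then qdiv (v b) (v a) else v p].

Lemma swapK a b : a != b -> cancel (swap a b) (unswap a b).
Proof.
move=> ab v; apply/ffunP => p; rewrite !ffunE !eqxx [b == a]eq_sym (negPf ab).
by case: (eqVneq p a) => [->//|_]; case: (eqVneq p b) => [->|//]; rewrite qopK.
Qed.

Lemma unswapK a b : a != b -> cancel (unswap a b) (swap a b).
Proof.
move=> ab v; apply/ffunP => p; rewrite !ffunE !eqxx [b == a]eq_sym (negPf ab).
by case: (eqVneq p a) => [->|_]; [rewrite qdivK | case: (eqVneq p b) => [->|]].
Qed.

Lemma swap_braid a b c v : a != b -> b != c -> a != c ->
  swap a b (swap b c (swap a b v)) = swap b c (swap a b (swap b c v)).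
Proof.
move=> ab bc ac; apply/ffunP => p; rewrite !ffunE !eqxx.
have [ba cb ca] : [/\ b != a, c != b & c != a] by split; rewrite eq_sym.
rewrite !(negPf ab, negPf bc, negPf ac, negPf ba, negPf cb, negPf ca).
case: (eqVneq p a) => [->|pa].
  by rewrite ?(negPf ab, negPf ac) -qopD.
case: (eqVneq p b) => [//|pb].
by case: (eqVneq p c).
Qed.

Lemma swap_comm a b c d v : uniq [:: a; b; c; d] ->
  swap a b (swap c d v) = swap c d (swap a b v).
Proof.
rewrite /= !inE !negb_or -!andbA => /and5P[ab ac ad bc /andP[bd /andP[cd _]]].
have [ca da] : [/\ c != a & d != a] by split; rewrite eq_sym.
have [cb db] : [/\ c != b & d != b] by split; rewrite eq_sym.
apply/ffunP => p; rewrite !ffunE.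
rewrite !(negPf ac, negPf ad, negPf bc, negPf bd, negPf ca, negPf da, negPf cb, negPf db).
case: (eqVneq p a) => [->|pa]; first by rewrite (negPf ac) (negPf ad).
by case: (eqVneq p b) => [->|pb]; first by rewrite (negPf bc) (negPf bd).
Qed.

End Swap.

Section BraidAction.
Local Open Scope group_scope.
Variables (Q : finQuandleType) (n : nat).
Notation V := {ffun 'I_n -> Q}.

Lemma left_right_neq (i : 'I_n.-1) : left_pos i != right_pos i.
Proof. by rewrite -val_eqE /= -[X in X != _]addn0 -addn1 eqn_add2l. Qed.

Definition swap_perm (i : 'I_n.-1) : {perm V} :=
  perm (can_inj (swapK (left_right_neq i))).

Definition letter_perm (a : 'I_n.-1 * bool) : {perm V} :=
  if a.2 then swap_perm a.1 else (swap_perm a.1)^-1.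

Lemma letter_permE a v : letter_perm a v =
  if a.2 then swap (left_pos a.1) (right_pos a.1) v
         else unswap (left_pos a.1) (right_pos a.1) v.
Proof.
case: a => i [] /=; rewrite /letter_perm /=; first by rewrite permE.
by apply: (canLR (permK _)); rewrite permE unswapK ?left_right_neq.
Qed.

(** Permutations compose from left to right, so letters act in reading order, from the top of the
    braid down. *)
Definition word_perm (w : seq ('I_n.-1 * bool)) : {perm V} :=
  \prod_(a <- w) letter_perm a.

Lemma word_perm_cat u w : word_perm (u ++ w) = word_perm u * word_perm w.
Proof. exact: big_cat. Qed.

Lemma word_perm_cong u w : wcong (@braid_rel n) u w -> word_perm u = word_perm w.
Proof.
elim=> {u w} [u w uw|//|u w _ -> //|u w r _ -> _ -> //|u u' w w' _ IHu _ IHw|i b].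
- case: uw => [i j ij|i j ij]; apply/permP => v.
    rewrite /word_perm !big_cons !big_nil !mulg1 !permM !letter_permE /=.
    have Ej : left_pos j = right_pos i by apply: val_inj; rewrite /= ij.
    rewrite Ej swap_braid //; first exact: left_right_neq.
    + by rewrite -Ej left_right_neq.
    + by rewrite -val_eqE /= ij; apply/eqP; lia.
  rewrite /word_perm !big_cons !big_nil !mulg1 !permM !letter_permE /=.
  rewrite swap_comm //= !inE -!val_eqE /=.
  by move: ij; clear; move: (val i) (val j) => a b ij; lia.
- by rewrite !word_perm_cat IHu IHw.
- rewrite /word_perm !big_cons !big_nil mulg1 /letter_perm /=.
  by case: b; rewrite /= ?mulgV ?mulVg.
Qed.

Definition braid_perm (s : braid_group n) : {perm V} :=
  word_perm (generic_quotient.repr s).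

Lemma braid_permM s t : braid_perm (s * t) = braid_perm s * braid_perm t.
Proof.
rewrite /braid_perm -word_perm_cat; apply: word_perm_cong; exact: wcong_repr.
Qed.

Lemma braid_perm_pi w :
  braid_perm (\pi_(presented_group (@braid_rel n)) w)%qT = word_perm w.
Proof. apply: word_perm_cong; exact: wcong_repr. Qed.

End BraidAction.

(** * Braid orbits as Hurwitz classes *)

Section Orbits.
Local Open Scope group_scope.
Variables (Q : finQuandleType) (n : nat).
Notation V := {ffun 'I_n -> Q}.
Implicit Types (v : V) (i : 'I_n.-1).

Definition coloring_word v : seq Q := [seq v p | p <- enum 'I_n].

Lemma size_coloring_word v : size (coloring_word v) = n.
Proof. by rewrite size_map size_enum_ord. Qed.

Lemma coloring_word_inj : injective coloring_word.
Proof.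
by move=> u v /eq_in_map uv; apply/ffunP => p; apply: uv; rewrite mem_enum.
Qed.

Lemma coloring_word_surj s : size s = n -> exists v, coloring_word v = s.
Proof.
move/eqP => szs; exists [ffun p => tnth (Tuple szs) p].
rewrite -[RHS](map_tnth_enum (Tuple szs)).
by apply: eq_map => p; rewrite ffunE.
Qed.

Lemma enum_split i : exists e1 e2,
  [/\ size e1 = i, enum 'I_n = e1 ++ [:: left_pos i, right_pos i & e2]
    & uniq (e1 ++ [:: left_pos i, right_pos i & e2])].
Proof.
exists (take i (enum 'I_n)), (drop i.+2 (enum 'I_n)).
have lt_i : i.+1 < n by have := ltn_ord (right_pos i).
have E : enum 'I_n = take i (enum 'I_n) ++
    [:: left_pos i, right_pos i & drop i.+2 (enum 'I_n)].
  rewrite -{1}[enum 'I_n](cat_take_drop i) (drop_nth (left_pos i)).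
    rewrite (drop_nth (left_pos i)) ?size_enum_ord //.
    congr (_ ++ [:: _, _ & _]); apply: val_inj; rewrite /= nth_enum_ord //.
    exact: ltnW.
  by rewrite size_enum_ord ltnW.
split=> //; last by rewrite -E enum_uniq.
by rewrite size_takel // size_enum_ord ltnW // ltnW.
Qed.

Lemma coloring_word_swap i v :
  exists s t, [/\ size s = i,
    coloring_word v = s ++ [:: v (left_pos i), v (right_pos i) & t]
  & coloring_word (swap (left_pos i) (right_pos i) v)
    = s ++ [:: qop (v (left_pos i)) (v (right_pos i)), v (left_pos i) & t]].
Proof.
have [e1 [e2 [sz E U]]] := enum_split i.
exists (map v e1), (map v e2); rewrite size_map /coloring_word E !map_cat /=.
split=> //; move: U; rewrite cat_uniq /= !inE !negb_or.
case/andP => _ /andP[/andP[l1 /andP[r1 _]] /andP[/andP[lr l2] /andP[r2 _]]].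
have off e : left_pos i \notin e -> right_pos i \notin e ->
    map (swap (left_pos i) (right_pos i) v) e = map v e.
  move=> le re; apply/eq_in_map => p pe; rewrite ffunE.
  case: eqP => [Ep|_]; first by rewrite -Ep pe in le.
  by case: eqP => [Ep|_]; first by rewrite -Ep pe in re.
rewrite !off // !ffunE !eqxx eq_sym (negPf lr) //.
Qed.

Lemma hurwitz_letter_perm a v :
  hurwitz (coloring_word v) (coloring_word (letter_perm Q a v)).
Proof.
have pos i u : hurwitz (coloring_word u) (coloring_word (swap_perm Q i u)).
  rewrite permE; have [s [t [_ -> ->]]] := coloring_word_swap i u.
  exact: hurwitz_step.
case: a => i [] /=; rewrite /letter_perm /=; first exact: pos.
by apply: hurwitz_sym; rewrite -{2}(permKV (swap_perm Q i) v); apply: pos.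
Qed.

Lemma hurwitz_word_perm w v :
  hurwitz (coloring_word v) (coloring_word (word_perm Q w v)).
Proof.
elim: w v => [|a w IHw] v.
  by rewrite /word_perm big_nil perm1; apply: hurwitz_refl.
rewrite /word_perm big_cons permM.
exact: hurwitz_trans (hurwitz_letter_perm a v) (IHw _).
Qed.

Lemma braid_perm1 : braid_perm Q (1 : braid_group n) = 1.
Proof.
apply: (mulgI (braid_perm Q (1 : braid_group n))).
by rewrite -braid_permM !mulg1.
Qed.

Definition braid_image : {set {perm V}} :=
  [set h | `[< exists s : braid_group n, braid_perm Q s = h >]].

Lemma mem_braid_image (s : braid_group n) : braid_perm Q s \in braid_image.
Proof. by rewrite inE; apply/asboolP; exists s. Qed.

Lemma braid_imageP h :
  reflect (exists s : braid_group n, braid_perm Q s = h) (h \in braid_image).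
Proof. by rewrite inE; apply: asboolP. Qed.

Lemma braid_image_group_set : group_set braid_image.
Proof.
apply/group_setP; split; first by rewrite -braid_perm1 mem_braid_image.
move=> _ _ /braid_imageP[s <-] /braid_imageP[t <-].
by rewrite -braid_permM mem_braid_image.
Qed.

Canonical braid_image_group := Group braid_image_group_set.

Lemma mem_word_perm w : word_perm Q w \in braid_image.
Proof. by rewrite -braid_perm_pi mem_braid_image. Qed.

(** A Hurwitz step after a prefix of length [i] is the action of generator [i], counted from 0. *)
Lemma orbit_hurwitz u v :
  v \in orbit 'P braid_image u <-> hurwitz (coloring_word u) (coloring_word v).
Proof.
split=> [/orbitP[_ /braid_imageP[s <-] <-]|]; first exact: hurwitz_word_perm.
suff H s t : hurwitz s t -> forall u v, coloring_word u = s -> coloring_word v = t ->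
    v \in orbit 'P braid_image u by move/H; apply.
move=> {u v}; elim=> {s t} [s x y t|s|s t _ IH|s t r st IH1 _ IH2] u v Eu Ev.
- have lt_s : size s < n.-1.
    have := congr1 size Eu; rewrite size_coloring_word size_cat /= => ->.
    by rewrite !addnS /= ltnS leq_addr.
  pose i := Ordinal lt_s.
  have [s' [t' [szs Eu' Esw]]] := coloring_word_swap i u.
  apply/orbitP; exists (swap_perm Q i).
    rewrite -[swap_perm Q i]mulg1.
    have -> : swap_perm Q i * 1 = word_perm Q [:: (i, true)].
      by rewrite /word_perm big_seq1 mulg1.
    exact: mem_word_perm.
  apply: coloring_word_inj; rewrite /= /aperm permE Ev Esw.
  move/eqP: Eu'; rewrite Eu eqseq_cat // => /andP[/eqP <- /eqP[-> -> ->]].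
  by [].
- by rewrite (coloring_word_inj (etrans Ev (esym Eu))) orbit_refl.
- by rewrite orbit_sym; apply: IH.
(* Hurwitz moves preserve length, so the intermediate word also comes from a coloring. *)
- have [w Ew] : exists w, coloring_word w = t.
    apply: coloring_word_surj.
    by rewrite -(hurwitz_size st) -Eu size_coloring_word.
  exact: orbit_trans (IH2 w v Ew Ev) (IH1 u w Eu Ew).
Qed.

(* Every Hurwitz orbit contains exactly one irreducible monomial. *)
Lemma card_orbits (G : pred (seq Q)) :
  (forall s t, hurwitz s t -> G s = G t) ->
  #|orbit 'P braid_image @: [set v | G (coloring_word v)]|
  = count (fun j => ~~ `[< reducible (enum Q) j >] && G (monomial (enum Q) j))
      (compositions #|Q| n).
Proof.
move=> GH; set xs := enum Q; set P := fun j => _ && _.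
have mon j : j \in compositions #|Q| n ->
    size j = size xs /\ exists v, coloring_word v = monomial xs j.
  rewrite mem_compositions => /andP[/eqP szj /eqP sumj].
  have szj' : size j = size xs by rewrite szj cardE.
  by split=> //; apply: coloring_word_surj; rewrite size_monomial.
(* Without colorings ([Q] empty and [n > 0]) both sides are zero; otherwise [v0] is the default
   value in [f]. *)
case: (pickP [pred v : V | true]) => [v0 _|V0]; last first.
  rewrite (eq_card0 (A := _ @: _)).
    apply/esym/eqP; rewrite -leqn0 leqNgt -has_count.
    by apply/hasP => -[j /mon[_ [v _]] _]; have := V0 v.
  by move=> O; apply/imsetP => -[v]; have := V0 v.
pose f j := odflt v0 [pick v | coloring_word v == monomial xs j].
have fE j : j \in compositions #|Q| n -> coloring_word (f j) = monomial xs j.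
  move=> /mon[_ [v Ev]]; rewrite /f; case: pickP => [u /eqP //|/(_ v)].
  by rewrite Ev eqxx.
pose L := [seq orbit 'P braid_image (f j) | j <- compositions #|Q| n & P j].
rewrite -size_filter -(size_map (fun j => orbit 'P braid_image (f j))) -/L.
have uniqL : uniq L.
  rewrite map_inj_in_uniq ?filter_uniq ?compositions_uniq // => j j'.
  rewrite !mem_filter => /andP[/andP[/asboolPn irrj _] jn].
  move=> /andP[/andP[/asboolPn irrj' _] j'n] Eo.
  have [szj _] := mon j jn; have [szj' _] := mon j' j'n.
  apply: (@irreducible_unique _ xs j j') => //.
  by rewrite -(fE j jn) -(fE j' j'n); apply/orbit_hurwitz; rewrite Eo orbit_refl.
rewrite -(card_uniqP uniqL); apply: eq_card => O; apply/imsetP/mapP.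
  move=> [v]; rewrite inE => Gv ->.
  have [|j [szj irrj vj]] := @irreducible_exists _ xs (coloring_word v).
    by move=> x; rewrite mem_enum.
  have jn : j \in compositions #|Q| n.
    rewrite mem_compositions szj cardE eqxx /=.
    by rewrite -(size_monomial szj) -(hurwitz_size vj) size_coloring_word.
  exists j; last first.
    by apply/esym/orbit_eqP/orbit_hurwitz; rewrite fE //; apply: hurwitz_sym.
  rewrite mem_filter jn andbT; apply/andP; split; first exact/asboolPn.
  by rewrite -(GH _ _ vj).
move=> [j]; rewrite mem_filter => /andP[/andP[irrj Gj] jn] ->.
by exists (f j) => //; rewrite inE fE.
Qed.

End Orbits.

(** * Colorings of braid closures *)

Section PresentedMorphisms.
Variables (A : Type) (rel : qterm A -> qterm A -> Prop) (Q : finQuandleType).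
Implicit Types (s t : qterm A) (f : A -> Q).

Fixpoint qeval f t : Q :=
  match t with
  | QGen a => f a
  | QOp s t => qop (qeval f s) (qeval f t)
  | QInv s t => qdiv (qeval f s) (qeval f t)
  end.

Definition respects f := forall s t, rel s t -> qeval f s = qeval f t.

Lemma qeval_cong f s t : respects f -> qcong rel s t -> qeval f s = qeval f t.
Proof.
move=> fR; elim=> {s t} //=.
- by move=> s t u _ -> _ ->.
- by move=> s s' t t' _ -> _ ->.
- by move=> s s' t t' _ -> _ ->.
- by move=> s; rewrite qopxx.
- by move=> s t; rewrite qopK.
- by move=> s t; rewrite qdivK.
- by move=> s t u; rewrite qopD.
Qed.

Definition presented_hom f (x : presented_quandle rel) : Q :=
  qeval f (generic_quotient.repr x).

Lemma presented_hom_pi f t :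
  respects f -> presented_hom f (\pi_(presented_quandle rel) t)%qT = qeval f t.
Proof. by move=> fR; apply: (qeval_cong fR); apply: qcong_repr. Qed.

Lemma presented_hom_morphism f : respects f -> quandle_morphism (presented_hom f).
Proof.
move=> fR x y; rewrite -[qop x y]/(pq_op x y) -[x]reprK -[y]reprK.
by rewrite pq_op_pi !presented_hom_pi.
Qed.

Lemma morphism_pi (F : presented_quandle rel -> Q) t :
  quandle_morphism F ->
  F (\pi_(presented_quandle rel) t)%qT = qeval (F \o @pq_gen A rel) t.
Proof.
move=> FM; elim: t => [a //|s IHs t IHt|s IHs t IHt] /=.
  by rewrite -pq_op_pi -IHs -IHt -FM.
rewrite -IHs -IHt -pq_inv_pi; apply: (can_inj (qopK (F (\pi s)%qT))).
by rewrite qdivK -FM; congr F; apply: pq_invK.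
Qed.

Lemma morphism_respects (F : presented_quandle rel -> Q) :
  quandle_morphism F -> respects (F \o @pq_gen A rel).
Proof.
move=> FM s t st; rewrite -!morphism_pi //; congr F.
exact/qpiP/qcong_rel.
Qed.

Lemma presented_hom_gen (F : presented_quandle rel -> Q) :
  quandle_morphism F -> presented_hom (F \o @pq_gen A rel) = F.
Proof.
by move=> FM; apply/funext => x; rewrite -[RHS]/(F x) -{2}[x]reprK morphism_pi.
Qed.

Lemma qeval_closed f (C : {set Q}) t :
  qclosed C -> (forall a, f a \in C) -> qeval f t \in C.
Proof.
move=> /qclosedP CC fC; elim: t => [a|s IHs t IHt|s IHs t IHt] /=; first exact: fC.
  by rewrite (CC _ IHs).
by rewrite -(CC _ IHs) qdivK.
Qed.

End PresentedMorphisms.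

(** * Colorings of the closure as fixed points of the braid *)

Section ClosureColorings.
Variables (Q : finQuandleType) (n : nat) (w : seq ('I_n.-1 * bool)).
Notation V := {ffun 'I_n -> Q}.
Notation D := (braid_closure w).
Notation segment := ('I_n * 'I_(size w).+1)%type.
Implicit Types (v : V) (x y : segment) (k : 'I_(size w)).

(** Colors propagated down from the top without regard to the closing strands; they are constant on
    arcs once [v] is fixed by [w]. *)
Definition segment_color v x : Q := word_perm Q (take x.2 w) v x.1.

Lemma segment_color0 v p : segment_color v (p, ord0) = v p.
Proof. by rewrite /segment_color take0 /word_perm big_nil perm1. Qed.

Lemma segment_color_max v p : segment_color v (p, ord_max) = word_perm Q w v p.
Proof. by rewrite /segment_color /= take_size. Qed.

Lemma segment_color_below v k p :
  segment_color v (p, below k)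
  = letter_perm Q (letter k) (word_perm Q (take k w) v) p.
Proof.
rewrite /segment_color /= /bump leq0n add1n (take_nth (letter k)) //.
rewrite -cats1 word_perm_cat permM /word_perm big_seq1.
by rewrite [letter k in RHS](tnth_nth (letter k)).
Qed.

Lemma segment_color_over v k p : p != under_top k ->
  segment_color v
    (tperm (left_pos (letter k).1) (right_pos (letter k).1) p, below k)
  = segment_color v (p, above k).
Proof.
rewrite segment_color_below letter_permE /under_top /segment_color /=.
have := left_right_neq (letter k).1.
set u := word_perm _ _ _; set l := left_pos _; set r := right_pos _ => lr.
case: ((letter k).2) => pu; case: tpermP => [Ep|Ep|/eqP pl /eqP pr]; rewrite ffunE.
- by rewrite eq_sym (negPf lr) eqxx Ep.
- by rewrite Ep eqxx in pu.
- by rewrite (negPf pl) (negPf pr).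
- by rewrite Ep eqxx in pu.
- by rewrite eqxx Ep.
- by rewrite (negPf pl) (negPf pr).
Qed.

Lemma segment_color_under v k :
  segment_color v (over_top k, below k)
  = (if (letter k).2 then @qop Q else @qdiv Q)
      (segment_color v (over_top k, above k))
      (segment_color v (under_top k, above k)).
Proof.
rewrite segment_color_below letter_permE /under_top /over_top /segment_color /=.
have := left_right_neq (letter k).1.
set u := word_perm _ _ _; set l := left_pos _; set r := right_pos _ => lr.
case: ((letter k).2); rewrite ffunE eqxx //.
by rewrite eq_sym (negPf lr).
Qed.

Lemma arc_of_continues x y : continues x y -> arc_of x = arc_of y.
Proof.
move=> xy; apply: val_inj; apply/eqP; rewrite /= root_connect //; last exact: joined_sym.
by apply: connect1; rewrite /joined xy.
Qed.

Lemma arc_of_val (a : closure_arc w) : arc_of (val a) = a.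
Proof. by apply: val_inj; case: a => x /= /eqP. Qed.

Lemma arc_of_over k p : p != under_top k ->
  arc_of (tperm (left_pos (letter k).1) (right_pos (letter k).1) p, below k)
  = arc_of (p, above k).
Proof.
move=> pu; apply/esym/arc_of_continues/orP; left.
by apply/existsP; exists k; rewrite !eqxx pu.
Qed.

Lemma arc_of_closing p : arc_of (p, @ord_max (size w)) = arc_of (p, ord0).
Proof. by apply/arc_of_continues/orP; right; rewrite !eqxx. Qed.

(** At a crossing [continues] avoids the under-strand and keeps the color for any [v]; the closing
    strands are where [vfix] enters. *)
Lemma segment_color_joined v x y :
  word_perm Q w v = v -> arc_of x = arc_of y -> segment_color v x = segment_color v y.
Proof.
move=> vfix /(congr1 val)/= /eqP; rewrite root_connect; last exact: joined_sym.
have cont z t : continues z t -> segment_color v z = segment_color v t.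
  case: z t => [p i] [q j] /orP[/existsP[k]|] /=.
    case/and4P => /eqP -> /eqP -> pu /eqP ->.
    by rewrite segment_color_over.
  case/and3P => /eqP -> /eqP -> /eqP ->.
  by rewrite segment_color_max segment_color0 vfix.
move=> /connectP[p]; elim: p x => [|z p IHp] x /=; first by move=> _ ->.
by move=> /andP[/orP[/cont ->|/cont <-] /IHp].
Qed.

Definition closure_hom v : fundamental_quandle D -> Q :=
  presented_hom (fun a : closure_arc w => segment_color v (val a)).

Lemma segment_color_arc v x : word_perm Q w v = v ->
  segment_color v (val (arc_of x)) = segment_color v x.
Proof. by move=> vfix; apply: segment_color_joined => //; apply: arc_of_val. Qed.

Lemma closure_respects v : word_perm Q w v = v ->
  respects (@wirtinger_rel D) (fun a : closure_arc w => segment_color v (val a)).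
Proof.
move=> vfix _ _ [k].
have E := segment_color_under v k.
rewrite -3!(segment_color_arc (_, _) vfix) in E.
transitivity (segment_color v (val (arc_of (over_top k, below k)))); last by [].
by rewrite E [positive k]/=; case: ((letter k).2).
Qed.

Lemma closure_hom_morphism v :
  word_perm Q w v = v -> quandle_morphism (closure_hom v).
Proof. by move=> vfix; apply/presented_hom_morphism/closure_respects. Qed.

Lemma closure_hom_gen v x : word_perm Q w v = v ->
  closure_hom v (pq_gen _ (arc_of x)) = segment_color v x.
Proof.
move=> vfix; rewrite [LHS]presented_hom_pi; last exact: closure_respects.
exact: segment_color_arc.
Qed.

Definition top_colors (F : fundamental_quandle D -> Q) : V :=
  [ffun p => F (pq_gen _ (arc_of (p, ord0)))].

(** Induction on the level. Below a crossing a segment either continues an arc from above or is the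
    outgoing under-strand, whose color the Wirtinger relation dictates. *)
Lemma morphism_segment_color F x : quandle_morphism F ->
  F (pq_gen _ (arc_of x)) = segment_color (top_colors F) x.
Proof.
move=> FM; have FR := morphism_respects FM.
case: x => p [k ltk]; elim: k ltk p => [|k IHk] ltk p.
  have -> : Ordinal ltk = ord0 by apply: val_inj.
  by rewrite segment_color0 ffunE.
pose K : 'I_(size w) := Ordinal (ltk : (k < size w)%N).
have -> : Ordinal ltk = below K by apply: val_inj.
have IH q : F (pq_gen _ (arc_of (q, above K)))
      = segment_color (top_colors F) (q, above K).
  have -> : above K = Ordinal (ltnW ltk) by apply: val_inj.
  exact: IHk.
(* [q] is the position, above the crossing, of the strand that reaches [p]. *)
rewrite -[p](tpermK (left_pos (letter K).1) (right_pos (letter K).1)).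
set q := tperm _ _ p; case: (eqVneq q (under_top K)) => [->|qu]; last first.
  by rewrite arc_of_over // segment_color_over // IH.
have -> : tperm (left_pos (letter K).1) (right_pos (letter K).1) (under_top K)
      = over_top K.
  by rewrite /under_top /over_top; case: ifP; rewrite ?tpermL ?tpermR.
rewrite segment_color_under -!IH.
have := FR _ _ (WirtingerRel (D := D) K).
by rewrite /=; case: ((letter K).2).
Qed.

Lemma top_colors_fixed F : quandle_morphism F ->
  word_perm Q w (top_colors F) = top_colors F.
Proof.
move=> FM; apply/ffunP => p; rewrite -segment_color_max -segment_color0.
by rewrite -!morphism_segment_color // arc_of_closing.
Qed.

Lemma closure_homK v : word_perm Q w v = v -> top_colors (closure_hom v) = v.
Proof.
by move=> vfix; apply/ffunP => p; rewrite ffunE closure_hom_gen // segment_color0.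
Qed.

Lemma top_colorsK F : quandle_morphism F -> closure_hom (top_colors F) = F.
Proof.
move=> FM; rewrite -[RHS](presented_hom_gen FM); congr presented_hom.
by apply/funext => a; rewrite -morphism_segment_color // arc_of_val.
Qed.

(** Forwards, a closed set containing the top colors contains the colors at every level, hence the
    range. Backwards, the range is itself closed and contains the top colors. *)
Lemma closure_hom_range v : word_perm Q w v = v ->
  range (closure_hom v) = setT <-> generating (coloring_word v).
Proof.
move=> vfix; split=> [surj|/forallP gen].
  apply/forallP => C; apply/implyP => /andP[CC vC].
  apply/eqP/setP => q; rewrite inE.
  have [x _ <-] : range (closure_hom v) q by rewrite surj.
  apply: qeval_closed => // a.
  have := hurwitz_closed CC (hurwitz_word_perm (take (val a).2 w) v).
  by rewrite vC => /esym/allP; apply; apply/map_f; rewrite mem_enum.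
have FM := closure_hom_morphism vfix.
pose C := [set q | `[< range (closure_hom v) q >]].
have /eqP CT : C == [set: Q].
  apply: (implyP (gen C)); apply/andP; split.
    apply/qclosedP => q; rewrite inE => /asboolP[x _ <-] y; rewrite 2!inE.
    apply/asboolP/asboolP => -[z _].
      (* Surjectivity of [qop x] on the fundamental quandle provides the preimage needed for closure
         under division. *)
      have [h _ hK] := qop_bij x.
      rewrite -(hK z) FM => /(can_inj (qopK _)) <-.
      by exists (h z).
    by move=> <-; exists (qop x z).
  apply/allP => _ /mapP[p _ ->]; rewrite /= inE; apply/asboolP.
  by exists (pq_gen _ (arc_of (p, ord0))) => //; rewrite closure_hom_gen // segment_color0.
apply/seteqP; split=> // q _.
by have : q \in C by [rewrite CT inE]; rewrite inE => /asboolP.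
Qed.

Lemma Col_image :
  Col Q D = [set closure_hom v | v in [set v | word_perm Q w v = v]]%classic.
Proof.
apply/seteqP; split=> [F FM|_ [v vfix <-]]; last exact: closure_hom_morphism.
by exists (top_colors F); [apply: top_colors_fixed | apply: top_colorsK].
Qed.

Lemma Col_dom_image :
  Col_dom Q D = [set closure_hom v | v in
    [set v | word_perm Q w v = v /\ generating (coloring_word v)]]%classic.
Proof.
apply/seteqP; split=> [F [FM FT]|_ [v [vfix gen] <-]].
  exists (top_colors F); last exact: top_colorsK.
  have Ffix := top_colors_fixed FM.
  by split=> //; apply/(closure_hom_range Ffix); rewrite top_colorsK.
by split; [apply: closure_hom_morphism | apply/closure_hom_range].
Qed.

End ClosureColorings.

Lemma card_fset_set_image (T : choiceType) (V : finType) (f : V -> T) (B : {set V}) :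
  {in B &, injective f} ->
  (#|` fset_set [set f v | v in [set v | v \in B]]|)%fset%classic = #|B|.
Proof.
move=> finj; set A := [set f v | v in _]%classic.
have -> : A = [set` [fset f v | v in B]%fset]%classic.
  apply/seteqP; split=> [_ [v /= vB <-]|_ /= /imfsetP[v vB ->]].
    by apply/imfsetP; exists v.
  by exists v.
by rewrite set_fsetK card_in_imfset //= -cardE.
Qed.

(** * Counting fixed points with Burnside's lemma *)

Section Counts.
Variables (Q : finQuandleType) (n : nat).
Notation V := {ffun 'I_n -> Q}.

Lemma closure_hom_inj w :
  {in [pred v | word_perm Q w v == v] &, injective (@closure_hom Q n w)}.
Proof.
move=> u v /eqP ufix /eqP vfix /(congr1 (@top_colors _ _ _)).
by rewrite !closure_homK.
Qed.

(** The predicate [S] treats both counts together: [xpredT] for all colorings, [generating] for the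
    dominant ones. *)
Lemma fixE (S : pred (seq Q)) (h : {perm V}) (v : V) :
  (v \in 'Fix_([set v : V | S (coloring_word v)] | 'P)[h])%g
  = S (coloring_word v) && (h v == v).
Proof. by rewrite !inE finset.sub1set inE. Qed.

Lemma col_countE (s : braid_group n) :
  col_count Q s
  = #|'Fix_([set v : V | xpredT (coloring_word v)] | 'P)[braid_perm Q s]|%g.
Proof.
have /= fixv := fixE xpredT (braid_perm Q s).
rewrite /col_count Col_image -(card_fset_set_image
  (f := @closure_hom Q n (generic_quotient.repr s))).
  congr (#|` fset_set _|)%fset; congr (_ @` _)%classic.
  by apply/funext => v; apply/propext; rewrite /= fixv; split=> /eqP.
by move=> u v; rewrite !fixv => uf vf; apply: closure_hom_inj.
Qed.

Lemma col_dom_countE (s : braid_group n) :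
  col_dom_count Q s
  = #|'Fix_([set v : V | generating (coloring_word v)] | 'P)[braid_perm Q s]|%g.
Proof.
rewrite /col_dom_count Col_dom_image -(card_fset_set_image
  (f := @closure_hom Q n (generic_quotient.repr s))).
  congr (#|` fset_set _|)%fset; congr (_ @` _)%classic.
  apply/funext => v; apply/propext; rewrite /= fixE.
  by split=> [[/eqP vf ->]|/andP[-> /eqP]].
move=> u v; rewrite !fixE => /andP[_ uf] /andP[_ vf]; exact: closure_hom_inj.
Qed.

(** Cauchy-Frobenius, with orbits counted by [card_orbits]; Hurwitz invariance of [S] makes the set
    of colorings stable under the action. *)
Lemma sum_fix (S : pred (seq Q)) : (forall s t, hurwitz s t -> S s = S t) ->
  \sum_(h in braid_image Q n)
     #|'Fix_([set v : V | S (coloring_word v)] | 'P)[h]%g|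
  = count (fun j => ~~ `[< reducible (enum Q) j >] && S (monomial (enum Q) j))
      (compositions #|Q| n) * #|braid_image Q n|.
Proof.
move=> SH; rewrite Frobenius_Cauchy ?card_orbits //.
apply/actsP => h hH v; rewrite !inE; apply/esym/SH.
by apply/orbit_hurwitz; apply: mem_orbit.
Qed.

End Counts.

Definition irreducible_count (Q : finQuandleType) (S : pred (seq Q)) n : nat :=
  count (fun j => ~~ `[< reducible (enum Q) j >] && S (monomial (enum Q) j))
    (compositions #|Q| n).

Section IrreducibleCounts.
Local Open Scope ring_scope.

Lemma irreducible_count_poly (Q : finQuandleType) :
  eventually_poly (fun n => (irreducible_count (Q := Q) xpredT n)%:Z).
Proof.
have red := avoiding_poly #|Q| (@reducible_upclosed Q (enum Q)).
apply: (@eventually_poly_eq _ _ 0%N _ red).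
by move=> n _; congr Posz; apply: eq_count => j; rewrite andbT.
Qed.

(** The exponents avoiding the union are the irreducible ones that do not generate; they are
    subtracted from all irreducible ones. *)
Lemma irreducible_generating_count_poly (Q : finQuandleType) :
  eventually_poly (fun n => (irreducible_count (@generating Q) n)%:Z).
Proof.
have red := avoiding_poly #|Q| (@reducible_upclosed Q (enum Q)).
have gen := avoiding_poly #|Q| (@reducible_or_generating_upclosed Q (enum Q)).
apply: (@eventually_poly_eq _ _ 0%N _ (eventually_polyD red (eventually_polyN gen))).
move=> n _; apply/eqP; rewrite subr_eq -PoszD eqz_nat; apply/eqP.
rewrite /avoiding /irreducible_count; elim: compositions => //= j L ->.
by rewrite asbool_or asboolb; case: `[< _ >]; case: generating => /=; lia.
Qed.

End IrreducibleCounts.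

(** * Integration over the profinite completion *)

Section Density.
Local Open Scope group_scope.
Local Open Scope classical_set_scope.
Variable G : groupType.
Notation Ghat := (profinite_completion G).

(** Cosets of the intersection are intersections of cosets, hence finite in number. This
    directedness makes [coset_filter] a filter. *)
Lemma finite_index_normalI (N M : finite_index_normal G) :
  exists L : finite_index_normal G, fin_set L = fin_set N `&` fin_set M.
Proof.
have L1 : (fin_set N `&` fin_set M) 1 by split; exact: fin1.
have LM x y : (fin_set N `&` fin_set M) x -> (fin_set N `&` fin_set M) y ->
    (fin_set N `&` fin_set M) (x * y).
  by move=> [Nx Mx] [Ny My]; split; exact: finM.
have LV x : (fin_set N `&` fin_set M) x -> (fin_set N `&` fin_set M) x^-1.
  by move=> [Nx Mx]; split; exact: finV.
have LJ x y : (fin_set N `&` fin_set M) x -> (fin_set N `&` fin_set M) (x ^ y).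
  by move=> [Nx Mx]; split; exact: finJ.
have Lfin : finite_set
    (range (fun x => [set y | (fin_set N `&` fin_set M) (x^-1 * y)])).
  apply: sub_finite_set
    (finite_image2 (fun A B => A `&` B) (fin_finite N) (fin_finite M)).
  move=> _ [x _ <-].
  exists [set y | fin_set N (x^-1 * y)]; first by exists x.
  by exists [set y | fin_set M (x^-1 * y)]; first by exists x.
by exists (FiniteIndexNormal L1 LM LV LJ Lfin).
Qed.

(** Generated by the sets of elements of [G] that approximate [x] modulo some [N]; its convergence
    to [x] expresses the density of [G]. *)
Definition coset_filter (x : Ghat) : set_system G :=
  filter_from [set: finite_index_normal G]
    (fun N => [set g | component x N = \pi_(quotient_group N)%qT g]).

Lemma coset_filter_proper x : ProperFilter (coset_filter x).
Proof.
have cosetI (N M L : finite_index_normal G) g : fin_set L = fin_set N `&` fin_set M ->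
    component x L = \pi_(quotient_group L)%qT g ->
    component x N = \pi_(quotient_group N)%qT g.
  by move=> LNM; apply: componentP; rewrite LNM; apply: subIsetl.
apply: filter_from_proper; last first.
  by move=> N _; exists (generic_quotient.repr (component x N)); rewrite /= reprK.
apply: filter_from_filter => [|N M _ _].
  have Tfin : finite_set (range (fun x : G => [set y : G | [set: G] (x^-1 * y)])).
    by apply: sub_finite_set (finite_set1 setT) => _ [? _ <-]; apply/seteqP.
  by exists (@FiniteIndexNormal G setT I
    (fun _ _ _ _ => I) (fun _ _ => I) (fun _ _ _ => I) Tfin).
have [L LNM] := finite_index_normalI N M; exists L => // g /= xg.
split; first exact: (cosetI N M L).
by apply: (cosetI M N L) => //; rewrite setIC.
Qed.

Lemma open_component (N : finite_index_normal G) (A : set (quotient_group N)) :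
  open [set x : Ghat | A (component x N)].
Proof.
exists [set f | A (f N)] => //.
rewrite openE => f Af.
have /cvg_sup/(_ N) : f --> f by apply: cvg_id.
apply; exists [set f | A (f N)]; split=> //.
by exists A => //; apply: discrete_open.
Qed.

(** Convergence is tested on each factor, where the component already equals that of [x] on a member
    of the filter. *)
Lemma to_completion_cvg x : @to_completion G @ coset_filter x --> x.
Proof.
have FF := coset_filter_proper x.
have cvg_product :
    (fun g => to_product (to_completion g)) @ coset_filter x --> to_product x.
  apply/cvg_sup => N U [_ [[B oB <-] Bx] BU].
  exists N => // g /= xg; apply: BU; rewrite /= /to_product /= -xg; exact: Bx.
move=> A [_ [[C oC <-] Cx] CA].
apply: (@filterS _ (coset_filter x) _ _ _ _ (cvg_product C _)).
  by move=> g Cg; apply: CA.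
exact: open_nbhs_nbhs.
Qed.

End Density.

(** * Haar integrals of functions factoring through a finite group *)

Section FiniteImage.
Local Open Scope group_scope.
Local Open Scope classical_set_scope.
Variables (G : groupType) (gT : finGroupType) (rho : G -> gT).
Hypothesis rhoM : forall x y, rho (x * y) = rho x * rho y.
Notation Ghat := (profinite_completion G).

Lemma hom1 : rho 1 = 1.
Proof. by apply: (mulgI (rho 1)); rewrite -rhoM !mulg1. Qed.

Lemma homV x : rho x^-1 = (rho x)^-1.
Proof. by apply: (mulgI (rho x)); rewrite -rhoM !mulgV hom1. Qed.

(** The index is finite because cosets of the kernel are fibers of [rho], indexed by elements of
    [gT]. *)
Lemma rho_kernel : exists N : finite_index_normal G,
  forall x, fin_set N x <-> rho x = 1.
Proof.
have K1 : [set x | rho x = 1] 1 by rewrite /= hom1.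
have KM x y : [set x | rho x = 1] x -> [set x | rho x = 1] y ->
    [set x | rho x = 1] (x * y).
  by move=> /= rx ry; rewrite rhoM rx ry mulg1.
have KV x : [set x | rho x = 1] x -> [set x | rho x = 1] x^-1.
  by move=> /= rx; rewrite homV rx invg1.
have KJ x y : [set x | rho x = 1] x -> [set x | rho x = 1] (x ^ y).
  by move=> /= rx; rewrite /conjg !rhoM rx homV mul1g mulVg.
have Kfin : finite_set (range (fun x => [set y | [set x | rho x = 1] (x^-1 * y)])).
  apply: sub_finite_set
    (finite_image (fun h => [set y | rho y = h]) (@finite_finset gT setT)).
  move=> _ [x _ <-]; exists (rho x) => //.
  apply/seteqP; split=> y /=; rewrite rhoM homV.
    by move=> ->; rewrite mulVg.
  by move=> /(canRL (mulKg _)) ->; rewrite invgK mulg1.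
by exists (FiniteIndexNormal K1 KM KV KJ Kfin).
Qed.

(** [rho] factors through the quotient by its kernel, so [rhohat] reads off the component there; a
    representative in [G] of this component shows that the image does not grow. *)
Lemma completion_map : exists rhohat : Ghat -> gT,
  [/\ forall g, rhohat (to_completion g) = rho g,
      forall x y, rhohat (x * y) = rhohat x * rhohat y,
      forall x, exists g, rho g = rhohat x
    & forall A : set gT, open [set x | A (rhohat x)]].
Proof.
have [N NP] := rho_kernel.
pose r (a : quotient_group N) := rho (generic_quotient.repr a).
have rpi g : r (\pi_(quotient_group N)%qT g) = rho g.
  have := coset_repr N g; rewrite NP rhoM homV => /(canRL (mulKg _)) ->.
  by rewrite invgK mulg1.
exists (fun x => r (component x N)); split=> [g|x y|x|A].
- exact: rpi.
- by rewrite [LHS]rpi rhoM.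
- by eexists.
- exact: (open_component (fun a => A (r a))).
Qed.

(** [F \o rhohat] gives existence, so [get] returns an extension [c]. Both [c] and [rhohat] are
    locally constant, so some [g] in [G] close to [x] takes the values of both at [x]. *)
Lemma continuous_extensionE (rhohat : Ghat -> gT) (F : gT -> nat) :
  (forall g, rhohat (to_completion g) = rho g) ->
  (forall A : set gT, open [set x | A (rhohat x)]) ->
  continuous_extension (F \o rho) = F \o rhohat.
Proof.
move=> rhohatE rhohat_open; set c := continuous_extension _.
have [cC cE] : continuous c /\ forall g, c (to_completion g) = (F \o rho) g.
  apply: (@getPex _ [set c : Ghat -> nat | continuous c /\
    forall g, c (to_completion g) = (F \o rho) g]); exists (F \o rhohat).
  split=> [|g]; last by rewrite /= rhohatE.
  by apply/continuousP => A _; apply: (rhohat_open (F @^-1` A)).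
apply/funext => x; have FF := coset_filter_proper x.
have c_near : (coset_filter x) [set g | c (to_completion g) = c x].
  apply: (@to_completion_cvg G x [set y | c y = c x]).
  apply: (cC x [set c x]); apply: open_nbhs_nbhs; split; first exact: discrete_open.
  by [].
have r_near : (coset_filter x) [set g | rhohat (to_completion g) = rhohat x].
  apply: (@to_completion_cvg G x [set y | rhohat y = rhohat x]).
  by apply: open_nbhs_nbhs; split=> //; apply: (rhohat_open [set rhohat x]).
have [g [/= <- <-]] := filter_ex (filterI c_near r_near).
by rewrite cE /= rhohatE.
Qed.

Local Open Scope ereal_scope.

(** The fibers of [rhohat] over [H] are translates of one another, so integration averages over [H],
    and [k] is the average of [F]. *)
Lemma haar_integral (R : realType) (mu : probability (borel_completion G) R)
    (H : {set gT}) (F : gT -> nat) (k : nat) :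
  is_haar mu -> (forall h, reflect (exists g, rho g = h) (h \in H)) ->
  (\sum_(h in H) F h = k * #|H|)%N ->
  \int[mu]_x ((continuous_extension (F \o rho) x)%:R)%:E = k%:R%:E.
Proof.
move=> haar HP sumF.
have [rhohat [rhohatE rhohatM rhohat_im rhohat_open]] := completion_map.
rewrite (continuous_extensionE F rhohatE rhohat_open).
pose fib h : set (borel_completion G) := [set x | rhohat x = h].
have mfib h : measurable (fib h).
  by apply: sub_sigma_algebra; apply: (rhohat_open [set h]).
have mufib h : h \in H -> mu (fib h) = mu (fib 1%g).
  move=> /HP[g gh]; rewrite -(haar (to_completion g) _ (mfib 1%g)); congr (mu _).
  apply/seteqP; split=> [x xh|_ [x x1 <-]].
    exists ((to_completion g)^-1 * x)%g; last by rewrite mulKVg.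
    apply: (mulgI (rhohat (to_completion g))).
    by rewrite -rhohatM mulKVg mulg1 rhohatE gh.
  by rewrite /fib /= rhohatM rhohatE gh x1 mulg1.
(* A general [E] allows the constant 1 as well, which says that the [#|H|] equal fibers have total
   mass one. *)
have intF (E : gT -> nat) :
    \int[mu]_x ((E (rhohat x))%:R)%:E = (\sum_(h in H) E h)%:R%:E * mu (fib 1%g).
  transitivity (\int[mu]_x \sum_(h <- enum H) ((E h)%:R%:E * (\1_(fib h) x)%:E)).
    apply: eq_integral => x _.
    have [g gx] := rhohat_im x; have xH : rhohat x \in enum H.
      by rewrite mem_enum; apply/HP; exists g.
    rewrite (bigD1_seq (rhohat x)) ?enum_uniq //= indicE mem_set // mule1.
    rewrite big1 ?adde0 // => h hx; rewrite indicE memNset ?mule0 //.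
    by move=> /= xh; rewrite xh eqxx in hx.
  rewrite ge0_integral_sum //; last first.
    move=> h; apply: measurable_funeM.
    by apply/measurable_EFinP; apply: measurable_indic.
  rewrite big_enum /= natr_sum -sumEFin ge0_sume_distrl; last first.
    by move=> h _; rewrite lee_fin.
  apply: eq_bigr => h hH; rewrite ge0_integralZl ?lee_fin //; last first.
    by apply/measurable_EFinP; apply: measurable_indic.
  by rewrite integral_indic // setIT; congr (_ * _); apply: mufib.
have one : 1 = #|H|%:R%:E * mu (fib 1%g).
  have := intF (fun=> 1%N); rewrite sum1_card => <-.
  by rewrite integral_cst // mul1e; apply/esym/(probability_setT mu).
have -> : \int[mu]_x ((F (rhohat x))%:R)%:E = k%:R%:E * 1.
  by rewrite intF sumF natrM EFinM -muleA -one.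
by rewrite mule1.
Qed.

End FiniteImage.

(** This equality holds for every [n]; only the passage to a polynomial requires [n] to be large. *)
Lemma average_coloring_integral (R : realType) (Q : finQuandleType) (n : nat)
    (mu : probability (borel_completion (braid_group n)) R) (S : pred (seq Q)) :
  is_haar mu -> (forall s t, hurwitz s t -> S s = S t) ->
  (\int[mu]_x ((continuous_extension
     (fun s => #|'Fix_([set v : {ffun 'I_n -> Q} | S (coloring_word v)] | 'P)
                    [braid_perm Q s]|%g) x)%:R)%:E
   = (irreducible_count S n)%:R%:E)%E.
Proof.
move=> haar SH.
exact: (haar_integral (@braid_permM Q n) haar (@braid_imageP Q n) (@sum_fix Q n S SH)).
Qed.

Local Open Scope ring_scope.

Theorem theorem2p26 (R : realType) (Q : finQuandleType) :
  exists P Pdom : {poly rat},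
    integer_valued P /\ integer_valued Pdom /\
    exists n0 : nat, forall n : nat, (n0 <= n)%N ->
    forall mu : probability (borel_completion (braid_group n)) R,
      is_haar mu ->
      (\int[mu]_x ((c_ Q x)%:R)%:E = (ratr P.[n%:R])%:E)%E /\
      (\int[mu]_x ((c_dom Q x)%:R)%:E = (ratr Pdom.[n%:R])%:E)%E.
Proof.
have [P [m [Pint HP]]] := irreducible_count_poly Q.
have [P' [m' [P'int HP']]] := irreducible_generating_count_poly Q.
exists P, P'; split=> //; split=> //; exists (maxn m m') => n.
rewrite geq_max => /andP[mn m'n] mu haar; split.
  rewrite -HP // ratr_int -(average_coloring_integral (S := xpredT) haar) //.
  by rewrite /c_ (functional_extensionality_dep (@col_countE Q n)).
rewrite -HP' // ratr_int -(average_coloring_integral haar (@generating_hurwitz Q)).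
by rewrite /c_dom (functional_extensionality_dep (@col_dom_countE Q n)).
Qed.
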